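(* Let $\widetilde{W}$ be an affine Weyl group of type $\widetilde{A}_2$, $\widetilde{B}_2$ or $\widetilde{G}_2$, with positive system $\widetilde\Phi^+$. The complete lattice $\mathscr{B}(\widetilde{\Phi}^+)$ of biclosed subsets of $\widetilde\Phi^+$, ordered by inclusion, is algebraic.
   Context: Affine setting: $\Phi$ is the irreducible crystallographic root system (finite and reduced, here of type $A_2$, $B_2$ or $G_2$) of a Weyl group, spanning a Euclidean space $V$ with inner product $(\cdot,\cdot)$, with a fixed positive system $\Phi^+$, simple system $\Pi$, $\Phi^-=-\Phi^+$. Let $V'=V\oplus\mathbb{R}\delta$, with the inner product extended by $(\delta,V')=0$. For $\alpha\in\Phi^+$ let $\widehat{\alpha}=\{\alpha+n\delta : n\in\mathbb{Z}_{\ge0}\}$; for $\alpha\in\Phi^-$ let $\widehat{\alpha}=\{\alpha+(n+1)\delta : n\in\mathbb{Z}_{\ge0}\}$; $\widetilde\Phi^+=\widehat{\Phi}=\bigcup_{\alpha\in\Phi}\widehat{\alpha}$. This is the positive system, with simple roots $\Pi\cup\{\delta-\gamma\}$ ($\gamma$ the highest root of $\Phi$), of the root system $\widehat\Phi\cup-\widehat\Phi$ of $\widetilde W$. A set $\Gamma\subset\widetilde\Phi^+$ is closed if $\alpha,\beta\in\Gamma$, $k_1,k_2\in\mathbb{R}_{\ge0}$ and $k_1\alpha+k_2\beta\in\widetilde\Phi^+$ imply $k_1\alpha+k_2\beta\in\Gamma$; it is biclosed if both $\Gamma$ and $\widetilde\Phi^+\setminus\Gamma$ are closed. In the types considered,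 $\mathscr{B}(\widetilde\Phi^+)$ is a complete lattice under inclusion. An element $x$ of a complete lattice is compact if $x\le\bigvee Y$ for a subset $Y$ implies $x\le\bigvee Y_0$ for some finite $Y_0\subset Y$. A complete lattice is algebraic if every element is a join of a set of compact elements. *)

(* Defs.v *)
From HB Require Import structures.
From mathcomp Require Import all_boot all_order all_algebra perm.
From mathcomp Require Import boolp classical_sets cardinality reals.

Set Implicit Arguments.
Unset Strict Implicit.
Unset Printing Implicit Defensive.

Import Order.TTheory GRing.Theory Num.Theory.
Local Open Scope classical_set_scope.
Local Open Scope ring_scope.

Section RootSystem.
Variables (R : realType) (V : vectType R) (dot : {dot V for idfun}).
Implicit Types (a b : V) (Phi : set V).

Definition cartan_number a b : R := 2 * dot a b / dot a a.

Definition root_reflection a b : V := b - cartan_number a b *: a.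

(* Finite, reduced and crystallographic, spanning V. *)
Record root_system Phi : Prop := RootSystem {
  root_finite : finite_set Phi;
  root_neq0 : forall a, Phi a -> a != 0;
  root_span : forall U : {vspace V},
    (forall a, Phi a -> a \in U) -> U = fullv;
  root_reflect : forall a b, Phi a -> Phi b -> Phi (root_reflection a b);
  root_reduced : forall a (c : R), Phi a -> Phi (c *: a) -> c = 1 \/ c = -1;
  root_crystallographic : forall a b,
    Phi a -> Phi b -> cartan_number a b \is a Num.int }.

Definition irreducible_root_system Phi :=
  Phi !=set0 /\
  forall A B : set V, A `|` B = Phi ->
    (forall a b, A a -> B b -> dot a b = 0) -> A = set0 \/ B = set0.

(* The simple roots are listed in an arbitrary order. *)
Definition simple_system Phi n (Pi : n.-tuple V) :=
  [/\ basis_of fullv Pi,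
      forall i, Phi (tnth Pi i)
    & forall a, Phi a -> (forall i, 0 <= coord Pi i a) \/
                         (forall i, coord Pi i a <= 0)].

Definition positive_roots Phi n (Pi : n.-tuple V) : set V :=
  [set a | Phi a /\ forall i, 0 <= coord Pi i a].

Definition negative_roots Phi n (Pi : n.-tuple V) : set V :=
  [set - a | a in positive_roots Phi Pi].

Definition cartan_matrix n (Pi : n.-tuple V) : 'M[R]_n :=
  \matrix_(i, j) cartan_number (tnth Pi i) (tnth Pi j).

End RootSystem.

Inductive rank2_type := A2 | B2 | G2.

Definition rank2_cartan (X : rank2_type) : 'M[int]_2 :=
  let m : int := match X with A2 => 1 | B2 => 2 | G2 => 3 end in
  \matrix_(i, j) (if i == j then 2 else if i == 0 then - 1 else - m).

(* Equality of Cartan matrices up to a reordering of the simple roots. *)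
Definition has_rank2_type (R : realType) (V : vectType R)
    (dot : {dot V for idfun}) (Pi : 2.-tuple V) (X : rank2_type) :=
  exists s : 'S_2, forall i j,
    cartan_matrix dot Pi (s i) (s j) = (rank2_cartan X i j)%:~R.

Section Affine.
Variables (R : realType) (V : vectType R).

(* V' = V (+) R delta; only its linear structure matters for closedness. *)
Definition affine_space : lmodType R := (V * R^o)%type.

Definition delta : affine_space := (0, 1).

Definition affine_embed (a : V) : affine_space := (a, 0).

Definition affine_positive_roots (Phi : set V) n (Pi : n.-tuple V) :
    set affine_space :=
  (\bigcup_(a in positive_roots Phi Pi)
     [set affine_embed a + k%:R *: delta | k in [set: nat]]) `|`
  (\bigcup_(a in negative_roots Phi Pi)
     [set affine_embed a + k.+1%:R *: delta | k in [set: nat]]).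

End Affine.

Section Biclosed.
Variables (R : realType) (U : lmodType R).
Implicit Types P G : set U.

Definition closed_in P G :=
  G `<=` P /\
  forall (x y : U) (k1 k2 : R), G x -> G y -> 0 <= k1 -> 0 <= k2 ->
    P (k1 *: x + k2 *: y) -> G (k1 *: x + k2 *: y).

Definition biclosed P G := closed_in P G /\ closed_in P (P `\` G).

Definition biclosed_set P := {G : set U | `[< biclosed P G >]}.

HB.instance Definition _ P := SubChoice.copy (biclosed_set P)
  {G : set U | `[< biclosed P G >]}.
HB.instance Definition _ P :=
  [SubChoice_isSubPOrder of biclosed_set P by <: with set_display].

End Biclosed.

Section Lattice.
Variables (d : Order.disp_t) (T : porderType d).
Implicit Types (x : T) (Y : set T).

Definition complete_lattice :=
  forall Y, supremums Y !=set0 /\ infimums Y !=set0.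

(* [supremums Y s] says that s is the join of Y; Y may be empty. *)
Definition compact_element x :=
  forall Y s, supremums Y s -> (x <= s)%O ->
    exists Y0 s0, [/\ finite_set Y0, Y0 `<=` Y, supremums Y0 s0 & (x <= s0)%O].

Definition algebraic_lattice :=
  complete_lattice /\
  forall x, exists2 K : set T, K `<=` compact_element & supremums K x.

End Lattice.
Arguments complete_lattice {d} T.
Arguments algebraic_lattice {d} T.

Lemma biclosed_set_leE (R : realType) (U : lmodType R) (P : set U)
    (G H : biclosed_set P) : (G <= H)%O = `[< sval G `<=` sval H >].
Proof. by rewrite -subsetEset asboolE. Qed.

(* Main.v *)
(* Let T be the following set of triples (x, y; z) of positive roots, called
   splittings of z: all sums z = x + y, and, in the list of the positive roots
   b + n delta, -b + n delta by increasing height (b a fixed positive root of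
   Phi), the triples formed by two consecutive roots and the next one, which
   is a positive combination of them. Both parts of a splitting are lower than
   z. The key point (affine_split_compat) is that if S is closed and coclosed
   for the splittings of the roots lower than z, then z cannot have one
   splitting with both parts in S and another with both parts outside S. By
   induction on the height, the hull for splittings of a coclosed set is
   therefore biclosed. Hence joins are hulls of unions, a biclosed hull of a
   finite set is compact, and every biclosed set is the increasing union of
   the hulls of its truncations by height, which are finite and coclosed. A
   minimal counterexample argument (biclosed_cone) shows that a set is
   biclosed in the real sense as soon as it is so for splittings. *)
Require Import Defs.
From mathcomp Require Import all_boot all_order all_algebra.
From mathcomp Require Import boolp classical_sets cardinality reals.
From mathcomp Require Import zify ring lra.

Set Implicit Arguments.
Unset Strict Implicit.
Unset Printing Implicit Defensive.

Import Order.TTheory GRing.Theory Num.Theory.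

(** * Hulls for a ternary relation *)

Section TernaryHull.
Variables (U : Type) (T : U -> U -> U -> Prop) (r : U -> nat).
Implicit Types (S : set U) (x y z : U).
Local Open Scope classical_set_scope.

Definition ternary_closed S := forall x y z, T x y z -> S x -> S y -> S z.

Definition ternary_coclosed S := forall x y z, T x y z -> S z -> S x \/ S y.

Definition ternary_biclosed_below n S := forall x y z, T x y z -> (r z < n)%N ->
  (S x -> S y -> S z) /\ (S z -> S x \/ S y).

(** Coclosedness is the contrapositive of closedness for the complement, so every later result about
    members of [S] also applies to non-members. *)
Lemma ternary_biclosed_belowC n S :
  ternary_biclosed_below n S -> ternary_biclosed_below n (~` S).
Proof.
move=> bS x y z Txyz zn; have [clS coS] := bS _ _ _ Txyz zn.
split=> [nSx nSy /coS[]//|nSz].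
by have [Sx|nSx] := pselect (S x); [right=> /(clS Sx)|left].
Qed.

(** Membership is a finite derivation: it uses only finitely many elements of [S], and its last step
    can be inspected. *)
Inductive ternary_hull S : set U :=
| ternary_hull_base z : S z -> ternary_hull S z
| ternary_hull_step x y z : T x y z ->
    ternary_hull S x -> ternary_hull S y -> ternary_hull S z.

Lemma ternary_hull_closed S : ternary_closed (ternary_hull S).
Proof. by move=> x y z; exact: ternary_hull_step. Qed.

Lemma ternary_hull_sub S S' :
  S `<=` S' -> ternary_closed S' -> ternary_hull S `<=` S'.
Proof. by move=> sS cS' z; elim=> {z} [z /sS|x y z /cS' + _ + _]; last apply. Qed.

Lemma ternary_hullS S S' : S `<=` S' -> ternary_hull S `<=` ternary_hull S'.
Proof.
move=> sS; apply: ternary_hull_sub (@ternary_hull_closed _).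
by move=> z /sS; exact: ternary_hull_base.
Qed.

Hypothesis T_compat : forall S x y x' y' z, ternary_biclosed_below (r z) S ->
  T x y z -> T x' y' z -> S x -> S y -> S x' \/ S y'.

(** Induction on the rank makes the hull biclosed below [z]. If [z] is in [S], coclosedness of [S]
    applies; otherwise the last step of its derivation is a splitting with both parts in the hull,
    and [T_compat] passes from it to the given one. *)
Lemma ternary_hull_coclosed S :
  ternary_coclosed S -> ternary_coclosed (ternary_hull S).
Proof.
move=> cS; suff H n x y z : (r z < n)%N -> T x y z -> ternary_hull S z ->
    ternary_hull S x \/ ternary_hull S y.
  by move=> x y z; exact: (H (r z).+1).
elim: n x y z => // n IHn x y z; rewrite ltnS => zn Txyz Hz.
have Hbi : ternary_biclosed_below (r z) (ternary_hull S).
  move=> a b c Tabc cz; split; first exact: ternary_hull_step.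
  by apply: IHn Tabc; exact: leq_trans cz zn.
case: z / Hz {zn} Txyz Hbi => [z Sz|a b z Tabz Ha Hb] Txyz Hbi.
  by case: (cS _ _ _ Txyz Sz) => ?; [left|right]; exact: ternary_hull_base.
exact: (T_compat Hbi Tabz Txyz).
Qed.

Lemma ternary_coclosed_bigcup I (D : set I) (F : I -> set U) :
  (forall i, D i -> ternary_coclosed (F i)) ->
  ternary_coclosed (\bigcup_(i in D) F i).
Proof.
move=> cF x y z Txyz [i Di Fiz].
by case: (cF i Di _ _ _ Txyz Fiz) => ?; [left|right]; exists i.
Qed.

Hypothesis T_lt : forall x y z, T x y z -> (r x < r z)%N /\ (r y < r z)%N.

Lemma ternary_coclosed_trunc S n :
  ternary_coclosed S -> ternary_coclosed (S `&` [set x | (r x < n)%N]).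
Proof.
move=> cS x y z Txyz [Sz /= zn]; have [xz yz] := T_lt Txyz.
by case: (cS _ _ _ Txyz Sz) => ?; [left|right]; split => //=;
  apply: leq_ltn_trans zn; exact: ltnW.
Qed.

Lemma ternary_hull_bigcup_finite I (D : set I) (F : I -> set U) z :
  ternary_hull (\bigcup_(i in D) F i) z ->
  exists D0, [/\ finite_set D0, D0 `<=` D &
                 ternary_hull (\bigcup_(i in D0) F i) z].
Proof.
elim=> {z} [z [i Di Fiz]|x y z Txyz _ [D1 [f1 s1 h1]] _ [D2 [f2 s2 h2]]].
  exists [set i]; split; [exact: finite_set1|by move=> _ ->|].
  by apply: ternary_hull_base; exists i.
exists (D1 `|` D2); split; first by rewrite finite_setU.
  by move=> i [/s1|/s2].
apply: ternary_hull_step Txyz _ _.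
  by apply: ternary_hullS h1; apply: bigcup_subset => i; left.
by apply: ternary_hullS h2; apply: bigcup_subset => i; right.
Qed.

Lemma finite_sub_ternary_hull_bigcup I (D : set I) (F : I -> set U) A :
  finite_set A -> A `<=` ternary_hull (\bigcup_(i in D) F i) ->
  exists D0, [/\ finite_set D0, D0 `<=` D &
                 A `<=` ternary_hull (\bigcup_(i in D0) F i)].
Proof.
move=> fA sA.
(* The premise [A z] stands under the existential so that choice yields a total function. *)
have /choice[f fP] z : exists D0, A z -> [/\ finite_set D0, D0 `<=` D &
    ternary_hull (\bigcup_(i in D0) F i) z].
  have [Az|nAz] := pselect (A z); last by exists set0.
  by have [D0 HD0] := ternary_hull_bigcup_finite (sA _ Az); exists D0.
exists (\bigcup_(z in A) f z); split.
- by apply: bigcup_finite => // z /fP[].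
- by move=> i [z /fP[_ + _]]; apply.
- move=> z Az; have [_ _] := fP _ Az; apply: ternary_hullS => u [i fzi Fiu].
  by exists i => //; exists z.
Qed.

End TernaryHull.

(** * The complete lattice of biclosed sets *)

Section BiclosedLattice.
Variables (R : realType) (U : lmodType R) (P : set U).
Variables (T : U -> U -> U -> Prop) (r : U -> nat).
Local Open Scope classical_set_scope.

Hypothesis T_lt : forall x y z, T x y z -> (r x < r z)%N /\ (r y < r z)%N.
Hypothesis T_compat : forall (S : set U) x y x' y' z,
  ternary_biclosed_below T r (r z) S ->
  T x y z -> T x' y' z -> S x -> S y -> S x' \/ S y'.
Hypothesis T_sub : forall x y z, T x y z -> P z.
Hypothesis P_finite : forall n, finite_set (P `&` [set x | (r x < n)%N]).
Hypothesis biclosedP : forall G : set U, biclosed P G <->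
  [/\ G `<=` P, ternary_closed T G & ternary_coclosed T G].

Implicit Types (Y : set (biclosed_set P)) (G : biclosed_set P).

Lemma biclosed_ternary G :
  [/\ sval G `<=` P, ternary_closed T (sval G) & ternary_coclosed T (sval G)].
Proof. by apply/biclosedP; case: G => G /= /asboolP. Qed.

Lemma biclosed_ternary_hull (S : set U) :
  S `<=` P -> ternary_coclosed T S -> biclosed P (ternary_hull T S).
Proof.
move=> sSP cS; apply/biclosedP; split.
- by apply: ternary_hull_sub => // x y z /T_sub.
- exact: ternary_hull_closed.
- exact: (ternary_hull_coclosed T_compat cS).
Qed.

(** The hull as an element of the lattice, with its universal property; it serves both for joins and
    for hulls of truncations. *)
Lemma ternary_hull_supremum (S : set U) : S `<=` P -> ternary_coclosed T S ->
  exists2 H : biclosed_set P, sval H = ternary_hull T S &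
    forall G, (H <= G)%O <-> S `<=` sval G.
Proof.
move=> sSP cS; have /asboolP bH := biclosed_ternary_hull sSP cS.
exists (exist _ (ternary_hull T S) bH) => // G; rewrite biclosed_set_leE.
split=> [/asboolP /= sHG z Sz|sSG].
  by apply: sHG; exact: ternary_hull_base.
have [_ cG _] := biclosed_ternary G.
by apply/asboolP; exact: ternary_hull_sub.
Qed.

Lemma biclosed_supremums Y : exists2 H, supremums Y H &
  sval H = ternary_hull T (\bigcup_(G in Y) sval G).
Proof.
have sUP : \bigcup_(G in Y) sval G `<=` P.
  by apply: bigcup_sub => G _; have [] := biclosed_ternary G.
have cU : ternary_coclosed T (\bigcup_(G in Y) sval G).
  by apply: ternary_coclosed_bigcup => G _; have [] := biclosed_ternary G.
have [H HE Hle] := ternary_hull_supremum sUP cU.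
exists H => //; split=> [G YG|G Gub].
  by rewrite biclosed_set_leE; apply/asboolP => z Gz; rewrite HE;
    apply: ternary_hull_base; exists G.
apply/Hle; apply: bigcup_sub => G' /Gub.
by rewrite biclosed_set_leE => /asboolP.
Qed.

Lemma biclosed_supremumsE Y H : supremums Y H ->
  sval H = ternary_hull T (\bigcup_(G in Y) sval G).
Proof.
move=> supH; have [H' supH' <-] := biclosed_supremums Y.
by rewrite (is_subset1_supremums supH supH').
Qed.

Lemma biclosed_complete : complete_lattice (biclosed_set P).
Proof.
move=> Y; have [H supH _] := biclosed_supremums Y.
split; first by exists H.
(* The meet is the join of all lower bounds. *)
have [L [ubL leL] _] := biclosed_supremums (lbound Y).
by exists L; split=> [G YG|G lbG]; [apply: leL => G' /(_ _ YG)|exact: ubL].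
Qed.

(** Each of the finitely many elements of [F] is derived from finitely many members of [Y]; together
    these members form [Y0]. *)
Lemma compact_ternary_hull (F : set U) G :
  finite_set F -> sval G = ternary_hull T F -> compact_element G.
Proof.
move=> fF GE Y H supH; rewrite biclosed_set_leE => /asboolP.
rewrite (biclosed_supremumsE supH) GE => sFY.
have {}sFY : F `<=` ternary_hull T (\bigcup_(G in Y) sval G).
  by apply: subset_trans sFY => z; exact: ternary_hull_base.
have [Y0 [fY0 sY0 sF0]] := finite_sub_ternary_hull_bigcup fF sFY.
have [H0 supH0 H0E] := biclosed_supremums Y0.
exists Y0, H0; split => //; rewrite biclosed_set_leE; apply/asboolP.
by rewrite GE H0E; apply: ternary_hull_sub => //; exact: ternary_hull_closed.
Qed.

Lemma biclosed_algebraic : algebraic_lattice (biclosed_set P).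
Proof.
split=> [|G]; first exact: biclosed_complete.
have [sGP oG cG] := biclosed_ternary G.
pose F n := sval G `&` [set x | (r x < n)%N].
(* Parts of a splitting have lower rank than the whole, so [F n] is still coclosed and its hull is
   biclosed; the hull stays inside [G], which is closed. *)
exists [set K | exists n, sval K = ternary_hull T (F n)].
  move=> K [n KE]; apply: compact_ternary_hull KE.
  by apply: sub_finite_set (P_finite n) => x [/sGP].
have FP n : exists2 H : biclosed_set P, sval H = ternary_hull T (F n) &
    forall G, (H <= G)%O <-> F n `<=` sval G.
  apply: ternary_hull_supremum; first by move=> x [/sGP].
  exact: ternary_coclosed_trunc.
split=> [K [n KE]|H ubH]; rewrite biclosed_set_leE; apply/asboolP.
  by rewrite KE; apply: ternary_hull_sub oG => x [].
move=> z Gz; have [K KE Kle] := FP (r z).+1.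
have /Kle : (K <= H)%O by apply: ubH; exists (r z).+1.
by apply; split=> //=.
Qed.

End BiclosedLattice.
(** * Roots and heights *)

Section AlternatingSequence.
Implicit Types (N : nat) (g : nat -> Prop).

(** Two equal consecutive values force the next one, so below [N] the sequence alternates up to its
    first repetition and is constant from there on. *)
Definition alternating_then_constant N g := forall l, l.+2 < N ->
  (g l -> g l.+1 -> g l.+2) /\ (g l.+2 -> g l \/ g l.+1).

Lemma alternating_then_constantC N g : alternating_then_constant N g ->
  alternating_then_constant N (fun l => ~ g l).
Proof.
move=> g_step l /g_step[gl gl2]; split=> [nl nl1 /gl2[]//|nl2].
by have [g_l|] := pselect (g l); [right=> /(gl g_l)|left].
Qed.

Lemma seq_const N g j l : alternating_then_constant N g ->
  g j -> g j.+1 -> j <= l < N -> g l.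
Proof.
move=> g_step gj gj1 /andP[jl lN].
suff H k : (j + k).+1 < N -> g (j + k) /\ g (j + k).+1.
  have [->//|jl'] := eqVneq l j.
  have -> : l = (j + (l - j).-1).+1 by lia.
  by apply: (H _ _).2; lia.
elim: k => [|k IHk] kN; first by rewrite addn0.
have [gk gk1] : g (j + k) /\ g (j + k).+1 by apply: IHk; lia.
by rewrite addnS; split => //; apply: (g_step _ _).1 => //; lia.
Qed.

(** Strong induction for both parities at once. If [g m] holds and [g m.+2] fails, then [g m.+1]
    fails too and [g] is false from there on; so [i] and [j] are at most [m], and the induction
    hypothesis gives [g m.+1], since [m.+1] has the parity of [i] or of [j]. *)
Lemma seq_mixed N g i j t : alternating_then_constant N g ->
  odd i != odd j -> j < N -> g i -> g j -> odd t = odd i -> i <= t < N -> g t.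
Proof.
move=> g_step ij jN gi gj ti itN.
suff H m : m < N -> (i <= m /\ odd m = odd i) \/ (j <= m /\ odd m = odd j) -> g m.
  by apply: H; [lia|left; lia].
elim/ltn_ind: m => m IHm mN Hm.
have [->//|mi] := eqVneq m i; have [->//|mj] := eqVneq m j.
case: m => [|[|m]] in IHm mN Hm mi mj *; [lia|lia|].
have gm : g m.
  apply: IHm; [lia|lia|].
  by case: Hm => -[im /= om]; [left|right]; split;
    [lia|rewrite -om negbK|lia|rewrite -om negbK].
apply: contrapT => ngm2.
have ngm1 : ~ g m.+1 by move=> gm1; apply: ngm2; apply: (g_step _ mN).1.
have cN l : m < l < N -> ~ g l.
  by apply: seq_const (alternating_then_constantC g_step) ngm1 ngm2.
have im : i <= m by rewrite leqNgt; apply/negP => mi'; apply: (cN i) => //; lia.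
have jm : j <= m by rewrite leqNgt; apply/negP => mj'; apply: (cN j) => //; lia.
apply: ngm1; apply: IHm; [lia|lia|].
have [oi|oi] := boolP (odd m.+1 == odd i).
  by left; split; [exact: ltnW|exact/eqP].
by right; split; [exact: ltnW|move: oi ij; do 3!case: odd].
Qed.

(** If [g t] fails, then so does [g t.+1], by [seq_mixed] applied to [i] and [t.+1]; two consecutive
    failures persist up to [k]. *)
Lemma seq_between N g i t k : alternating_then_constant N g ->
  odd t = odd i -> i <= t <= k -> k < N -> g i -> g k -> g t.
Proof.
move=> g_step ti itk kN gi gk; have [->//|tk] := eqVneq t k.
apply: contrapT => ngt; have ngt1 : ~ g t.+1.
  by move=> gt1; apply: ngt; apply: (seq_mixed g_step _ _ gi gt1) => //; lia.
have /(_ k)[] := seq_const (alternating_then_constantC g_step) ngt ngt1.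
  by lia.
by [].
Qed.

End AlternatingSequence.

(** * Inner products of roots *)

Section AffineRootSystem.
Variables (R : realType) (V : vectType R) (dot : {dot V for idfun}%R).
Local Open Scope ring_scope.
Implicit Types (a b : V).

Lemma dotC a b : dot a b = dot b a.
Proof. by rewrite hermC expr0 mul1r. Qed.

Lemma dotDl a b c : dot (a + b) c = dot a c + dot b c.
Proof. by rewrite linearDl. Qed.

Lemma dotDr a b c : dot c (a + b) = dot c a + dot c b.
Proof. by rewrite linearDr. Qed.

Lemma dotZl k a b : dot (k *: a) b = k * dot a b.
Proof. by rewrite linearZl. Qed.

Lemma dotZr k a b : dot a (k *: b) = k * dot a b.
Proof. by rewrite linearZr. Qed.

Lemma dotNl a b : dot (- a) b = - dot a b.
Proof. by rewrite -scaleN1r dotZl mulN1r. Qed.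

Lemma dotNr a b : dot a (- b) = - dot a b.
Proof. by rewrite -scaleN1r dotZr mulN1r. Qed.

Definition dotE := (dotDl, dotDr, dotZl, dotZr, dotNl, dotNr).

Variable (Phi : set V).
Hypothesis Phi_root : root_system dot Phi.

Lemma root_dot_gt0 a : Phi a -> 0 < dot a a.
Proof. by move=> Pa; apply/neq0_dnorm_gt0/(root_neq0 Phi_root). Qed.

Lemma root_opp a : Phi a -> Phi (- a).
Proof.
move=> Pa; have := root_reflect Phi_root Pa Pa.
rewrite /root_reflection /cartan_number mulfK ?gt_eqF ?root_dot_gt0 //.
by rewrite -[X in X - _]scale1r -scalerBl opprD addrA subrr add0r scaleN1r.
Qed.

Lemma root_scale_eq a b k : Phi a -> Phi b -> a = k *: b -> a = b \/ a = - b.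
Proof.
move=> Pa Pb aE; move: Pa; rewrite aE => /(root_reduced Phi_root Pb)[]->.
  by left; rewrite scale1r.
by right; rewrite scaleN1r.
Qed.

(** Strict Cauchy-Schwarz for non-proportional vectors: [u], which is (b, b) times the component of
    a orthogonal to b, is nonzero. *)
Lemma cartan_number_mul_lt4 a b : Phi a -> Phi b -> a != b -> a != - b ->
  cartan_number dot a b * cartan_number dot b a < 4.
Proof.
move=> Pa Pb ab aNb; have aa := root_dot_gt0 Pa; have bb := root_dot_gt0 Pb.
pose u := dot b b *: a - dot a b *: b.
have u0 : u != 0.
  rewrite subr_eq0; apply/eqP => /(congr1 ( *:%R (dot b b)^-1)).
  rewrite !scalerA mulVf ?gt_eqF // scale1r => /(root_scale_eq Pa Pb)[] /eqP.
    by apply/negP.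
  by apply/negP.
have : 0 < dot u u by exact: neq0_dnorm_gt0.
rewrite /u !dotE [dot b a]dotC => uu.
have {uu}: 0 < dot a a * dot b b - dot a b * dot a b.
  rewrite -(pmulr_rgt0 _ bb); apply: lt_le_trans uu _.
  by rewrite le_eqVlt; apply/orP; left; apply/eqP; ring.
rewrite /cartan_number [dot b a]dotC subr_gt0 => H.
have -> : 2 * dot a b / dot a a * (2 * dot a b / dot b b) =
    4 * (dot a b * dot a b) / (dot a a * dot b b).
  by field; rewrite !gt_eqF.
by rewrite ltr_pdivrMr ?mulr_gt0 // ltr_pM2l.
Qed.

(** The two Cartan numbers are positive integers with product less than 4, so one of them is 1, and
    the corresponding reflection yields the difference up to sign. *)
Lemma root_sub a b : Phi a -> Phi b -> a != b -> 0 < dot a b -> Phi (a - b).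
Proof.
move=> Pa Pb ab dab; have aa := root_dot_gt0 Pa; have bb := root_dot_gt0 Pb.
have aNb : a != - b.
  by apply: contraTneq dab => ->; rewrite dotNl oppr_gt0 -leNgt ltW.
have := cartan_number_mul_lt4 Pa Pb ab aNb.
have ab0 : 0 < cartan_number dot a b by rewrite divr_gt0 ?mulr_gt0.
have ba0 : 0 < cartan_number dot b a.
  by rewrite divr_gt0 // dotC mulr_gt0.
have /intrP[p pE] := root_crystallographic Phi_root Pa Pb.
have /intrP[q qE] := root_crystallographic Phi_root Pb Pa.
have rab := root_reflect Phi_root Pa Pb; have rba := root_reflect Phi_root Pb Pa.
move: ab0 ba0 rab rba; rewrite /root_reflection pE qE !ltr0z => p0 q0 rab rba.
rewrite -intrM -[4]/(4%:~R) ltr_int => pq.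
have /orP[/eqP p1|/eqP q1] : (p == 1) || (q == 1) by nia.
  by rewrite -opprB; apply: root_opp; rewrite p1 scale1r in rab.
by rewrite q1 scale1r in rba.
Qed.

(** * Heights with respect to the simple roots *)

Variables (n : nat) (Pi : n.-tuple V).
Hypothesis Pi_simple : simple_system Phi Pi.

Definition height a : R := \sum_(i < n) coord Pi i a.

Lemma heightD a b : height (a + b) = height a + height b.
Proof. by rewrite -big_split; apply: eq_bigr => i _; rewrite linearD. Qed.

Lemma heightZ k a : height (k *: a) = k * height a.
Proof. by rewrite mulr_sumr; apply: eq_bigr => i _; rewrite linearZ. Qed.

Lemma heightN a : height (- a) = - height a.
Proof. by rewrite -scaleN1r heightZ mulN1r. Qed.

Lemma coord_simple i j : coord Pi i (tnth Pi j) = (i == j)%:R.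
Proof.
have [/basis_free fPi _ _] := Pi_simple.
by rewrite (tnth_nth 0) coord_free // eq_sym.
Qed.

Lemma height_simple i : height (tnth Pi i) = 1.
Proof.
rewrite /height (bigD1 i) //= coord_simple eqxx big1 ?addr0 // => j ji.
by rewrite coord_simple (negPf ji).
Qed.

Lemma simple_decomp a : a = \sum_(i < n) coord Pi i a *: tnth Pi i.
Proof.
have [bPi _ _] := Pi_simple.
rewrite {1}(coord_basis bPi (memvf a)); apply: eq_bigr => i _.
by rewrite (tnth_nth 0).
Qed.

Lemma simple_coord_eq a b : (forall i, coord Pi i a = coord Pi i b) -> a = b.
Proof.
move=> ab; rewrite [LHS]simple_decomp [RHS]simple_decomp.
by apply: eq_bigr => i _; rewrite ab.
Qed.

Lemma positive_height_gt0 a :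
  Phi a -> (forall i, 0 <= coord Pi i a) -> 0 < height a.
Proof.
move=> Pa a0; rewrite lt_def sumr_ge0 ?andbT => [|i _]; last exact: a0.
apply: contraNneq (root_neq0 Phi_root Pa) => h0; apply/eqP/simple_coord_eq => i.
rewrite linear0; apply/eqP; move/eqP: h0.
by rewrite psumr_eq0 => [/allP/(_ i)|j _]; [apply; rewrite mem_index_enum|].
Qed.

Lemma height_gt0 a : Phi a -> 0 < height a <-> forall i, 0 <= coord Pi i a.
Proof.
move=> Pa; split=> [h0|]; last exact: positive_height_gt0.
have [_ _ /(_ a Pa)[//|a0]] := Pi_simple.
suff : height a <= 0 by rewrite leNgt h0.
by apply: sumr_le0 => i _.
Qed.

Lemma height_neq0 a : Phi a -> height a != 0.
Proof.
move=> Pa; have [_ _ /(_ a Pa)[a0|a0]] := Pi_simple.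
  by rewrite gt_eqF ?positive_height_gt0.
rewrite -oppr_eq0 -heightN gt_eqF // positive_height_gt0 //.
  exact: root_opp.
by move=> i; rewrite linearN oppr_ge0; exact: a0.
Qed.

(** A positive root that is not simple remains a positive root after subtraction of a suitable
    simple root, which lowers the height by 1; the induction is on a natural bound for the
    height. *)
Lemma height_int a : Phi a -> height a \is a Num.int.
Proof.
suff H (N : nat) b : Phi b -> 0 < height b -> height b < N%:R ->
    height b \is a Num.int.
  move=> Pa; have [a0|a0] := ltP 0 (height a).
    exact: H Pa a0 (archi_boundP (ltW a0)).
  have Na0 : 0 < height (- a).
    by rewrite heightN oppr_gt0 lt_neqAle height_neq0.
  rewrite -[a]opprK heightN rpredN.
  exact: H (root_opp Pa) Na0 (archi_boundP (ltW Na0)).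
elim: N b => [|N IHN] b Pb b0 bN; first by have := lt_trans b0 bN; rewrite ltxx.
have bi := (height_gt0 Pb).1 b0.
(* Expanding the second b in (b, b) > 0 over the simple roots, some term is positive. *)
have [i ci di] : exists2 i, 0 < coord Pi i b & 0 < dot b (tnth Pi i).
  have bb := root_dot_gt0 Pb.
  apply: contrapT => nex; move: bb; rewrite ltNge => /negP; apply.
  rewrite {2}[b]simple_decomp linear_sum; apply: sumr_le0 => i _.
  rewrite -[leLHS]/(dot b _) dotZr.
  have := bi i; rewrite le_eqVlt => /orP[/eqP<-|ci]; first by rewrite mul0r.
  by rewrite pmulr_rle0 // leNgt; apply/negP => di; apply: nex; exists i.
have [_ PiPhi Pi_sign] := Pi_simple.
have [->|bPi] := eqVneq b (tnth Pi i); first by rewrite height_simple rpred1.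
have Pbi := root_sub Pb (PiPhi i) bPi di.
have bE : height b = height (b - tnth Pi i) + 1.
  by rewrite -(height_simple i) -heightD subrK.
rewrite bE rpredD ?rpred1 //; apply: IHN => //; last first.
  by move: bN; rewrite bE -natr1 ltrD2r.
apply/(height_gt0 Pbi); have [//|neg] := Pi_sign _ Pbi.
case/eqP: bPi.
(* If the difference is negative, all other coordinates of b vanish, and b is simple because [Phi]
   is reduced. *)
suff bE' : b = coord Pi i b *: tnth Pi i.
  have : Phi (coord Pi i b *: tnth Pi i) by rewrite -bE'.
  move=> /(root_reduced Phi_root (PiPhi i))[] c1.
    by rewrite bE' c1 scale1r.
  by move: ci; rewrite c1 oppr_gt0 ltr10.
apply: simple_coord_eq => j; rewrite linearZ /= coord_simple.
have [->|ji] := eqVneq j i; first by rewrite mulr1.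
rewrite mulr0; apply/eqP; rewrite eq_le bi andbT.
by have := neg j; rewrite linearB /= coord_simple (negPf ji) subr0.
Qed.

Lemma height_bounded : exists M : nat, forall a, Phi a -> `|height a| < M%:R.
Proof.
have /finite_seqP[s Phis] := root_finite Phi_root.
exists (Num.bound (\sum_(a <- s) `|height a|)) => a Pa.
apply: le_lt_trans (archi_boundP _); last by apply: sumr_ge0.
have as_ : a \in s by move: Pa; rewrite Phis.
by rewrite (big_rem a) //= lerDl sumr_ge0.
Qed.

(** * Positive affine roots and their rank *)

Variable M : nat.
Hypothesis height_lt : forall a, Phi a -> `|height a| < M%:R.
Implicit Types (p x y z : affine_space V) (S : set (affine_space V)).

Local Notation P := (affine_positive_roots Phi Pi).

(** Giving delta the height 2M, with M above all heights in [Phi], makes this linear form positive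
    on exactly the positive affine roots, and increasing along b, -b + delta, b + delta, ...: the
    steps are 2M - 2 height b and 2 height b. *)
Definition affine_height p : R := height p.1 + (2 * M)%:R * p.2.

Definition affine_rank p : nat := Num.truncn (affine_height p).

Definition affine_root p : Prop := Phi p.1 /\ p.2 \is a Num.int.

Definition aff a (m : nat) : affine_space V := (a, m%:R).

(* The least n such that a + n delta is positive. *)
Definition shift a : nat := ~~ (0 < height a).

Lemma shiftN a : Phi a -> (shift a + shift (- a) = 1)%N.
Proof.
move=> Pa; rewrite /shift heightN oppr_gt0.
by have := height_neq0 Pa; case: ltgtP.
Qed.

Lemma shiftD a b : Phi a -> Phi b -> Phi (a + b) ->
  (shift (a + b) <= shift a + shift b <= (shift (a + b)).+1)%N.
Proof.
move=> Pa Pb Pab; rewrite /shift heightD.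
have := height_neq0 Pa.
have := height_neq0 Pb.
have := height_neq0 Pab; rewrite heightD.
by case: (ltgtP 0 (height a)) => // a0; case: (ltgtP 0 (height b)) => // b0;
  case: (ltgtP 0 (height a + height b)) => // c0 _ _ _ //=; exfalso; lra.
Qed.

Lemma affE a m : aff a m = affine_embed a + m%:R *: delta V.
Proof.
rewrite /aff /affine_embed /delta; congr (_, _) => /=.
  by rewrite scaler0 addr0.
by rewrite add0r /GRing.scale /= mulr1.
Qed.

Lemma affD a b m k : aff a m + aff b k = aff (a + b) (m + k).
Proof. by rewrite /aff natrD. Qed.

Lemma affP p : P p <-> exists a m, [/\ Phi a, (shift a <= m)%N & p = aff a m].
Proof.
split=> [[[a [Pa a0] [m _ <-]]|[_ [a [Pa a0] <-] [m _ <-]]]|[a [m [Pa am ->]]]].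
- exists a, m; split; rewrite ?affE //.
  by rewrite /shift (height_gt0 Pa).2.
- exists (- a), m.+1; split; rewrite ?affE //; first exact: root_opp.
  by rewrite /shift; case: (_ < _).
- have [a0|a0] := ltP 0 (height a).
    left; exists a; first by split=> //; apply/(height_gt0 Pa).
    by exists m => //; rewrite affE.
  move: am; rewrite /shift ltNge a0 /=; case: m => // m _.
  right; exists a; last by exists m => //; rewrite affE.
  have PNa := root_opp Pa.
  exists (- a); last by rewrite opprK.
  split=> //; apply/(height_gt0 PNa).
  by rewrite heightN oppr_gt0 lt_neqAle a0 (height_neq0 Pa).
Qed.

Lemma aff_inj a b m k : aff a m = aff b k -> a = b /\ m = k.
Proof. by move=> [-> /(congr1 Num.truncn)]; rewrite !natrK. Qed.

Lemma aff_positive a m : P (aff a m) <-> Phi a /\ (shift a <= m)%N.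
Proof.
rewrite affP; split=> [[b [k [Pb bk /aff_inj[-> ->]]]]//|[Pa am]].
by exists a, m.
Qed.

Lemma affine_heightD x y :
  affine_height (x + y) = affine_height x + affine_height y.
Proof. by rewrite /affine_height heightD /=; ring. Qed.

Lemma affine_heightZ k x : affine_height (k *: x) = k * affine_height x.
Proof.
rewrite /affine_height heightZ /= mulrDr; congr (_ + _).
by rewrite /GRing.scale /=; ring.
Qed.

Lemma affine_heightN x : affine_height (- x) = - affine_height x.
Proof. by rewrite -scaleN1r affine_heightZ mulN1r. Qed.

Lemma affine_root_positive p : affine_root p -> 0 < affine_height p -> P p.
Proof.
case: p => a t [/= Pa /intrP[m ->]]; rewrite /affine_height /= => h0.
have /ltr_normlP[h1 h2] := height_lt Pa.
have m0 : 0 <= m.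
  rewrite leNgt; apply/negP => m0.
  have : (m%:~R : R) <= -1 by rewrite -[-1]/((-1)%:~R) ler_int; lia.
  move: h0; rewrite natrM => h0 m1.
  have : M%:R * (m%:~R : R) <= M%:R * -1 by rewrite ler_wpM2l.
  by have : 0 <= M%:R :> R by []; lra.
apply/affP; exists a, `|m|%N; split=> //; last first.
  by rewrite /aff -[in LHS](gez0_abs m0).
rewrite /shift; case: ltP => //= a0.
rewrite absz_gt0; apply: contraTneq h0 => ->.
by rewrite mulr0 addr0 -leNgt.
Qed.

Lemma affine_height_gt0 p : P p -> 0 < affine_height p.
Proof.
move=> /affP[a [m [Pa am ->]]]; rewrite /affine_height /=.
have /ltr_normlP[h1 h2] := height_lt Pa.
move: am; rewrite /shift natrM; case: ltP => /= [a0 _|a0 m0].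
  by rewrite ltr_pwDl ?mulr_ge0.
have m1 : 1 <= m%:R :> R by rewrite ler1n.
have : M%:R * 1 <= M%:R * m%:R :> R by rewrite ler_wpM2l.
have : 0 <= M%:R :> R by [].
by lra.
Qed.

Lemma positive_affine_root p : P p -> affine_root p.
Proof. by move=> /affP[a [m [Pa _ ->]]]; split => //=; rewrite intr_nat ?natr_nat. Qed.

Lemma affine_root_opp p : affine_root p -> affine_root (- p).
Proof. by case=> Pa pint; split; [exact: root_opp|rewrite rpredN]. Qed.

Lemma affine_height_int p : affine_root p -> affine_height p \is a Num.int.
Proof.
case=> Pa pint; rewrite rpredD ?height_int // rpredM //.
by rewrite intr_nat ?natr_nat.
Qed.

(** The affine height does not vanish: a nonzero multiple of 2M dominates the height of [p.1], and
    the latter is nonzero. *)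
Lemma affine_root_sign p : affine_root p -> P p \/ P (- p).
Proof.
move=> rp; have [h0|h0|h0] := ltgtP 0 (affine_height p).
- by left; exact: affine_root_positive.
- right; apply: affine_root_positive; first exact: affine_root_opp.
  by rewrite affine_heightN oppr_gt0.
- exfalso; case: p => a t in rp h0 *; case: rp => [/= Pa /intrP[m tE]].
  move: h0; rewrite /affine_height tE /= natrM => h0.
  have /ltr_normlP[h1 h2] := height_lt Pa.
  have M0 : 0 <= M%:R :> R by [].
  have := height_neq0 Pa.
  have [m0|m0|m0] := ltgtP m 0.
  + have : (m%:~R : R) <= -1 by rewrite -[-1]/((-1)%:~R) ler_int; lia.
    by move=> /(ler_wpM2l M0); lra.
  + have : 1 <= (m%:~R : R) by rewrite -[1]/(1%:~R) ler_int; lia.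
    by move=> /(ler_wpM2l M0); lra.
  + by move: h0; rewrite m0 mulr0 addr0 => <-; rewrite eqxx.
Qed.

Lemma affine_rankE p : P p -> (affine_rank p)%:R = affine_height p.
Proof.
move=> Pp; rewrite /affine_rank truncnK // natrEint.
rewrite (affine_height_int (positive_affine_root Pp)).
by rewrite ltW ?affine_height_gt0.
Qed.

Lemma affine_rankD x y : P x -> P y -> P (x + y) ->
  affine_rank (x + y) = (affine_rank x + affine_rank y)%N.
Proof.
move=> Px Py Pxy; apply/eqP; rewrite -(eqr_nat R) natrD !affine_rankE //.
by rewrite affine_heightD.
Qed.

Lemma affine_rank_gt0 x : P x -> (0 < affine_rank x)%N.
Proof. by move=> Px; rewrite -(ltr_nat R) affine_rankE // affine_height_gt0. Qed.

(** At level m >= 1 the affine height exceeds (2m - 1)M >= m, so the rank bounds the level, and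
    [Phi] is finite. *)
Lemma affine_rank_finite k : finite_set (P `&` [set p | (affine_rank p < k)%N])%classic.
Proof.
pose f (u : V * nat) := aff u.1 u.2.
apply: (@sub_finite_set _ _ (f @` (Phi `*` `I_k)))%classic; last first.
  by apply/finite_image/finite_setX; [exact: root_finite Phi_root|exact: finite_II].
move=> p [Pp /= pk]; have [a [m [Pa am pE]]] := (affP p).1 Pp.
exists (a, m) => //; split=> //=; apply: leq_ltn_trans pk.
rewrite -(ler_nat R) affine_rankE // pE /affine_height /= natrM.
have /ltr_normlP[h1 h2] := height_lt Pa.
case: m => [|m] in am pE *.
  by move: am; rewrite /shift mulr0 addr0; case: ltP => // /ltW.
have M0 : (0 < M)%N.
  by rewrite -(ltr_nat R); exact: le_lt_trans (normr_ge0 _) (height_lt Pa).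
have : 0 <= (M%:R - 1) * m%:R :> R by rewrite mulr_ge0 // subr_ge0 ler1n.
have : 0 <= M%:R * m%:R :> R by rewrite mulr_ge0.
have : 1 <= M%:R :> R by rewrite ler1n.
by rewrite -natr1; lra.
Qed.

Local Notation rank := affine_rank.

(** * Splittings of affine roots *)

(** The level [m.+1 - shift a] makes x, y, z consecutive in their chain for either sign of a. *)
Definition affine_split x y z : Prop :=
  [/\ P x, P y, P z & z = x + y] \/
  exists a m, [/\ Phi a, (shift a <= m)%N, x = aff a m,
                  y = aff (- a) (m.+1 - shift a) & z = aff a m.+1].

Local Notation below := (ternary_biclosed_below affine_split rank).

(** * Chains of affine roots over a root and its opposite *)

Definition positive_rep a := if 0 < height a then a else - a.

(** For positive a this enumerates a, -a + delta, a + delta, -a + 2 delta, ...; the parity of the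
    index tells the sign. *)
Definition chain a l : affine_space V :=
  if odd l then aff (- a) l.+1./2 else aff a l./2.

(** The index of a + m delta in the chain of the positive one of a, -a. *)
Definition chain_index a m := (m.*2 - shift a)%N.

Lemma positive_rep_opp a : Phi a -> positive_rep (- a) = positive_rep a.
Proof.
move=> Pa; rewrite /positive_rep heightN oppr_gt0 opprK.
by have := height_neq0 Pa; case: ltgtP.
Qed.

Lemma positive_rep_root a : Phi a -> Phi (positive_rep a).
Proof. by move=> Pa; rewrite /positive_rep; case: ifP => // _; exact: root_opp. Qed.

Lemma positive_rep_gt0 a : Phi a -> 0 < height (positive_rep a).
Proof.
move=> Pa; rewrite /positive_rep; case: ifPn => // a0.
rewrite heightN oppr_gt0 lt_neqAle (height_neq0 Pa) /=.
by rewrite leNgt.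
Qed.

Lemma chainE a m : Phi a -> (shift a <= m)%N ->
  aff a m = chain (positive_rep a) (chain_index a m).
Proof.
move=> Pa; rewrite /chain /chain_index /positive_rep /shift.
case: ltP => /= [_ _|_ m0].
  by rewrite subn0 odd_double doubleK.
case: m m0 => // m _; rewrite doubleS subn1 /= odd_double /= opprK.
by congr aff; lia.
Qed.

Lemma chain_index_odd a m : (shift a <= m)%N ->
  odd (chain_index a m) = (shift a == 1%N).
Proof. by rewrite /chain_index /shift; case: (_ < _) => /=; lia. Qed.

Lemma chain_positive b l : Phi b -> 0 < height b -> P (chain b l).
Proof.
move=> Pb b0; rewrite /chain; case: ifP => ol; apply/aff_positive.
  by split; [exact: root_opp|rewrite /shift; case: (_ < _) => //=; lia].
by rewrite /shift b0.
Qed.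

Lemma chain_split b l : Phi b -> 0 < height b ->
  affine_split (chain b l) (chain b l.+1) (chain b l.+2).
Proof.
move=> Pb b0; right; have := shiftN Pb; rewrite /shift b0 => sNb.
rewrite /chain /=; case: (boolP (odd l)) => ol /=.
  by exists (- b), l.+1./2; split; rewrite ?opprK //; first exact: root_opp;
    rewrite /shift; move: sNb; case: (_ < _) => //= _; (congr aff || idtac); lia.
by exists b, l./2; split; rewrite ?opprK // /shift b0 //=; congr aff; lia.
Qed.

Lemma chain_rank_lt b l k : Phi b -> 0 < height b -> (l < k)%N ->
  (rank (chain b l) < rank (chain b k))%N.
Proof.
move=> Pb b0; have := @homo_ltn _ (fun l => rank (chain b l)) (fun i j => i < j)%N.
apply=> {l k} [y x z|l]; first exact: ltn_trans.
rewrite /=  -(ltr_nat R) !affine_rankE //; try exact: chain_positive.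
have /ltr_normlP[h1 h2] := height_lt Pb.
rewrite /chain /=; case: (boolP (odd l)) => ol; rewrite /affine_height /= heightN.
  by rewrite ltrD2r; lra.
by rewrite natrM -natr1; lra.
Qed.

Lemma below_add k S x y : below k S -> P x -> P y -> P (x + y) ->
  (rank (x + y) < k)%N -> (S x -> S y -> S (x + y)) /\ (S (x + y) -> S x \/ S y).
Proof. by move=> bS Px Py Pxy; apply: bS; left. Qed.

Lemma below_chain k S b N : below k S -> Phi b -> 0 < height b ->
  (forall l, (l < N)%N -> (rank (chain b l) < k)%N) ->
  alternating_then_constant N (fun l => S (chain b l)).
Proof. by move=> bS Pb b0 bN l lN; apply: bS (chain_split l Pb b0) (bN _ lN). Qed.

Lemma chain_rank_bound k b m l : Phi b -> 0 < height b ->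
  (rank (chain b m) < k)%N -> (l < m.+1)%N -> (rank (chain b l) < k)%N.
Proof.
move=> Pb b0 mk; rewrite ltnS leq_eqVlt => /orP[/eqP->//|lm].
exact: ltn_trans (chain_rank_lt Pb b0 lm) mk.
Qed.

Lemma below_chain_max k S b i j : below k S -> Phi b -> 0 < height b ->
  (rank (chain b i) < k)%N -> (rank (chain b j) < k)%N ->
  alternating_then_constant (maxn i j).+1 (fun l => S (chain b l)).
Proof.
move=> bS Pb b0 ik jk; apply: (below_chain bS) => // l.
by apply: chain_rank_bound => //; rewrite /maxn; case: ifP.
Qed.

(** Roots over a and over -a have indices of opposite parities in their common chain, so this is
    [seq_mixed]. *)
Lemma below_opposite k S a m m' i : below k S -> Phi a ->
  (shift a <= m <= m')%N -> (shift (- a) <= i)%N ->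
  (rank (aff a m') < k)%N -> (rank (aff (- a) i) < k)%N ->
  S (aff a m) -> S (aff (- a) i) -> S (aff a m').
Proof.
move=> bS Pa /andP[am mm'] ai; have am' := leq_trans am mm'.
have PNa := root_opp Pa; have sN := shiftN Pa.
rewrite !chainE ?positive_rep_opp // => m'k ik Sm Si.
have bc := below_chain_max bS (positive_rep_root Pa) (positive_rep_gt0 Pa) m'k ik.
have oi := chain_index_odd ai; have om := chain_index_odd am.
have om' := chain_index_odd am'.
apply: (seq_mixed bc _ _ Sm Si); rewrite ?oi ?om ?om' //.
- by move: sN; case: (shift a) => [|[|?]]; case: (shift (- a)) => [|[|?]].
- by rewrite ltnS leq_maxr.
- by rewrite ltnS leq_maxl andbT /chain_index; lia.
Qed.

Lemma below_between k S a m t m' : below k S -> Phi a ->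
  (shift a <= m)%N -> (m <= t <= m')%N -> (rank (aff a m') < k)%N ->
  S (aff a m) -> S (aff a m') -> S (aff a t).
Proof.
move=> bS Pa am /andP[mt tm'].
have at_ := leq_trans am mt; have am' := leq_trans at_ tm'.
rewrite !chainE // => m'k Sm Sm'.
have bc := below_chain_max bS (positive_rep_root Pa) (positive_rep_gt0 Pa) m'k m'k.
have om := chain_index_odd am; have om' := chain_index_odd am'.
have ot := chain_index_odd at_.
apply: (seq_between bc _ _ _ Sm Sm'); rewrite ?om ?om' ?ot //.
  by rewrite /chain_index; lia.
by rewrite ltnS leq_maxl.
Qed.

(** The two lowest roots have indices 0 and 1, so membership is constant from the start. *)
Lemma below_ends k S a i : below k S -> Phi a -> (shift (- a) <= i)%N ->
  (rank (aff (- a) i) < k)%N ->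
  S (aff a (shift a)) -> S (aff (- a) (shift (- a))) -> S (aff (- a) i).
Proof.
move=> bS Pa ai; have PNa := root_opp Pa; have sN := shiftN Pa.
rewrite !chainE ?positive_rep_opp // => ik S0 S1.
have bc := below_chain_max bS (positive_rep_root Pa) (positive_rep_gt0 Pa) ik ik.
suff [S0' S1'] : S (chain (positive_rep a) 0) /\ S (chain (positive_rep a) 1).
  by apply: (seq_const bc S0' S1'); rewrite ltnS leq_maxl.
move: S0 S1; rewrite /chain_index; case: (shift a) sN => [|[|//]].
  by rewrite add0n => ->.
by rewrite add1n => -[->].
Qed.

(** * Comparing two splittings of one root *)

Lemma rank_ltl x y : P x -> P y -> P (x + y) -> (rank x < rank (x + y))%N.
Proof.
by move=> Px Py Pxy; rewrite affine_rankD // -[ltnLHS]addn0 ltn_add2l affine_rank_gt0.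
Qed.

Lemma rank_ltr x y : P x -> P y -> P (x + y) -> (rank y < rank (x + y))%N.
Proof. by rewrite addrC => Px Py; exact: rank_ltl. Qed.

Lemma affine_split_positive x y z :
  affine_split x y z -> [/\ P x, P y & P z].
Proof.
case=> [[Px Py Pz _]|[a [m [Pa am -> -> ->]]]] //.
have PNa := root_opp Pa; have sN := shiftN Pa.
by split; apply/aff_positive; split=> //; lia.
Qed.

Lemma affine_split_rank_lt x y z : affine_split x y z ->
  (rank x < rank z)%N /\ (rank y < rank z)%N.
Proof.
move=> Sxyz; have [Px Py Pz] := affine_split_positive Sxyz.
case: Sxyz => [[_ _ _ zE]|[a [m [Pa am xE yE zE]]]].
  by rewrite zE; split; [apply: rank_ltl|apply: rank_ltr]; rewrite // -zE.
have /ltr_normlP[h1 h2] := height_lt Pa.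
split; rewrite -(ltr_nat R) !affine_rankE // ?xE ?yE zE /affine_height /=.
  by rewrite ltrD2l natrM -natr1; have : 0 <= M%:R :> R by []; lra.
rewrite heightN; move: am; rewrite /shift; case: ltP => /= a0 am.
  by rewrite subn0 ltrD2r; lra.
by rewrite subn1 /= natrM -natr1; lra.
Qed.

(* No -b + i delta is in S: if b + (k - 1) delta is positive, it lies in S
   while b + k delta does not; otherwise b + k delta and its complement to
   delta, the two lowest roots of their chain, both miss S. *)
Lemma below_split_opposite S a m b k b' k' : below (rank (aff a m.+1)) S ->
  Phi a -> (shift a <= m)%N -> S (aff a m) ->
  Phi b -> (shift b <= k)%N -> Phi b' -> (shift b' <= k')%N ->
  a = b + b' -> m.+1 = (k + k')%N -> ~ S (aff b k) -> ~ S (aff b' k') ->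
  forall i, (shift (- b) <= i)%N -> (rank (aff (- b) i) < rank (aff a m.+1))%N ->
    ~ S (aff (- b) i).
Proof.
move=> bS Pa am Sm Pb bk Pb' bk' aE mE nSx nSy i bi ik.
have zE : aff a m.+1 = aff b k + aff b' k' by rewrite affD aE mE.
have Pz : P (aff a m.+1) by apply/aff_positive; split=> //; lia.
have Px : P (aff b k) by apply/aff_positive.
have Py : P (aff b' k') by apply/aff_positive.
have xz : (rank (aff b k) < rank (aff a m.+1))%N.
  by rewrite zE; apply: rank_ltl; rewrite // -zE.
have yz : (rank (aff b' k') < rank (aff a m.+1))%N.
  by rewrite zE; apply: rank_ltr; rewrite // -zE.
have mz : (rank (aff a m) < rank (aff a m.+1))%N.
  suff /affine_split_rank_lt[] : affine_split (aff a m)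
    (aff (- a) (m.+1 - shift a)) (aff a m.+1) by [].
  by right; exists a, m.
have Pm : P (aff a m) by apply/aff_positive.
have PNb := root_opp Pb; have sN := shiftN Pb.
have [bk0|kb] := ltnP (shift b) k.
  case: k bk0 bk mE nSx zE Px xz => // k bk _ mE nSx zE Px xz.
  (* Here the first part is b + (k + 1) delta. Removing one delta from it and from the whole, a + m
     delta is the sum of b + k delta and the second part, which is outside S. *)
  have Sbk : S (aff b k).
    have Pbk : P (aff b k) by apply/aff_positive.
    have mE' : aff a m = aff b k + aff b' k' by rewrite affD aE; congr aff; lia.
    by have [||_ []] := below_add bS Pbk Py; rewrite -?mE'.
  move=> Si; apply: nSx; apply: (below_opposite bS Pb _ bi xz ik Sbk Si).
  by lia.
have {kb bk}kE : k = shift b by lia.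
have PNb' : P (aff (- b) (shift (- b))) by apply/aff_positive.
(* The second part is a + m delta plus the lowest root over -b, which therefore cannot be in S. *)
have yE : aff b' k' = aff a m + aff (- b) (shift (- b)).
  by rewrite affD aE addrAC subrr add0r; congr aff; lia.
have nS0 : ~ S (aff (- b) (shift (- b))).
  move=> S0; apply: nSy; rewrite yE.
  by have [||+ _] := below_add bS Pm PNb'; rewrite -?yE //; apply.
have bSC := ternary_biclosed_belowC bS.
by apply: (below_ends bSC Pb bi ik) => //; rewrite -kE.
Qed.

Lemma affD_positive a b c m l t : Phi a -> Phi b -> Phi c ->
  (shift a <= m)%N -> (shift b <= l)%N -> c = a + b -> t = (m + l)%N ->
  [/\ P (aff a m), P (aff b l), P (aff c t) & aff c t = aff a m + aff b l].
Proof.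
move=> Pa Pb Pc am bl cE tE.
have := shiftD Pa Pb; rewrite -cE => /(_ Pc)/andP[sc _].
by split; rewrite ?affD ?cE ?tE //; apply/aff_positive; rewrite -?cE; split=> //; lia.
Qed.

Lemma aff_rank_lt a b c m l t : Phi a -> Phi b -> Phi c ->
  (shift a <= m)%N -> (shift b <= l)%N -> c = a + b -> t = (m + l)%N ->
  (rank (aff a m) < rank (aff c t))%N /\ (rank (aff b l) < rank (aff c t))%N.
Proof.
move=> Pa Pb Pc am bl cE tE.
have [Pm Pl Pt tE'] := affD_positive Pa Pb Pc am bl cE tE.
by rewrite tE'; split; [apply: rank_ltl|apply: rank_ltr]; rewrite // -tE'.
Qed.

Lemma below_aff k S a b c m l t : below k S -> Phi a -> Phi b -> Phi c ->
  (shift a <= m)%N -> (shift b <= l)%N -> c = a + b -> t = (m + l)%N ->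
  (rank (aff c t) < k)%N ->
  (S (aff a m) -> S (aff b l) -> S (aff c t)) /\
  (S (aff c t) -> S (aff a m) \/ S (aff b l)).
Proof.
move=> bS Pa Pb Pc am bl cE tE.
have [Pm Pl Pt tE'] := affD_positive Pa Pb Pc am bl cE tE.
by rewrite tE' in Pt * => tk; exact: (below_add bS).
Qed.

(** If x and y, lying over b and b', were both outside S, then by [below_split_opposite] no root
    over -b or -b' of rank lower than the whole would be in S. The part over -a is in S, and is in
    general a sum of two such roots. *)
Lemma below_chain_add S a m x y : below (rank (aff a m.+1)) S ->
  Phi a -> (shift a <= m)%N ->
  S (aff a m) -> S (aff (- a) (m.+1 - shift a)) ->
  P x -> P y -> aff a m.+1 = x + y -> S x \/ S y.
Proof.
move=> bS Pa am Sm So /affP[b [k [Pb bk ->]]] /affP[b' [k' [Pb' bk' ->]]].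
rewrite affD => /aff_inj[aE mE].
have [?|nSx] := pselect (S (aff b k)); first by left.
have [?|nSy] := pselect (S (aff b' k')); first by right.
exfalso.
have Nb := below_split_opposite bS Pa am Sm Pb bk Pb' bk' aE mE nSx nSy.
have aE' : a = b' + b by rewrite addrC.
have mE' : m.+1 = (k' + k)%N by rewrite addnC.
have Nb' := below_split_opposite bS Pa am Sm Pb' bk' Pb bk aE' mE' nSy nSx.
have PNa := root_opp Pa; have PNb := root_opp Pb; have PNb' := root_opp Pb'.
have sNa := shiftN Pa; have sNb := shiftN Pb; have sNb' := shiftN Pb'.
have NaE : - a = - b + - b' by rewrite aE opprD.
have /affine_split_rank_lt[mz oz] : affine_split (aff a m)
    (aff (- a) (m.+1 - shift a)) (aff a m.+1) by right; exists a, m.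
have /andP[sl su] : (shift a <= shift b + shift b' <= (shift a).+1)%N.
  by rewrite aE shiftD // -aE.
(* The level of the part over -a leaves room for positive roots over both -b and -b', unless m = 0
   and b, b' are positive. *)
have [large|small] := boolP ((0 < shift b + shift b') || (0 < m))%N.
  pose i := shift (- b); pose i' := (m.+1 - shift a - i)%N.
  have bi : (shift (- b) <= i)%N by [].
  have bi' : (shift (- b') <= i')%N by rewrite /i' /i; lia.
  have oE : (m.+1 - shift a = i + i')%N by rewrite /i' /i; lia.
  have [ri ri'] := aff_rank_lt PNb PNb' PNa bi bi' NaE oE.
  have [_ /(_ So)[]] := below_aff bS PNb PNb' PNa bi bi' NaE oE oz.
    by apply: Nb => //; exact: ltn_trans oz.
  by apply: Nb' => //; exact: ltn_trans oz.
have m0 : m = 0%N by lia.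
subst m; have sa : shift a = 0%N by lia.
rewrite sa subn0 in So oz; have sb : shift b = 0%N by lia.
have sb' : shift b' = 0%N by lia.
(* Now a, b, b' are positive, and the parts are c and (a - c) + delta, with c
   among b, b'. *)
have K c c' : Phi c -> Phi c' -> shift c = 0%N -> shift c' = 0%N ->
    a = c + c' -> ~ S (aff c 0) -> ~ S (aff c' 1) ->
    (forall i, (shift (- c) <= i)%N ->
      (rank (aff (- c) i) < rank (aff a 1))%N -> ~ S (aff (- c) i)) -> False.
  move=> Pc Pc' sc sc' acc' nc nc' Nc.
  have PNc := root_opp Pc; have sNc := shiftN Pc.
  (* a is in S and c is not, so c' is; then -c + delta, the sum of c' and -a + delta, is in S. *)
  have Sc' : S (aff c' 0).
    have c0 : (shift c <= 0)%N by rewrite sc.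
    have c0' : (shift c' <= 0)%N by rewrite sc'.
    by have [_ /(_ Sm)[]] := below_aff bS Pc Pc' Pa c0 c0' acc' (erefl : 0 = 0 + 0)%N mz.
  have cE : c' = a - c by rewrite acc' addrAC subrr add0r.
  have NcE : - c = c' - a by rewrite cE addrAC subrr add0r.
  have [_ r1] : (rank (aff a 0) < rank (aff c' 1))%N /\
                (rank (aff (- c) 1) < rank (aff c' 1))%N.
    by apply: (@aff_rank_lt a (- c) c') => //; lia.
  have [_ r2] : (rank (aff c 0) < rank (aff a 1))%N /\
                (rank (aff c' 1) < rank (aff a 1))%N.
    by apply: (@aff_rank_lt c c' a) => //; lia.
  have r3 := ltn_trans r1 r2.
  apply: (Nc 1%N) => //; first by lia.
  by apply: (below_aff (m := 0%N) (l := 1%N) bS Pc' PNa PNc _ _ NcE _ r3).1 => //; lia.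
have [[k0 k1]|[k0 k1]] : k = 0%N /\ k' = 1%N \/ k = 1%N /\ k' = 0%N by lia.
  by subst k k'; exact: (K b b').
by subst k k'; exact: (K b' b).
Qed.

(* If x and x' are not in the same chain and (x, x') > 0, then x - x' is a
   root, and moving it between the two decompositions gives a contradiction.
   *)
Lemma below_exchange S x y x' y' z : below (rank z) S ->
  P x -> P y -> P x' -> P y' -> P z -> z = x + y -> z = x' + y' ->
  S x -> S y -> ~ S x' -> ~ S y' -> 0 < dot x.1 x'.1 -> x.1 = x'.1.
Proof.
move=> bS Px Py Px' Py' Pz zE zE' Sx Sy nSx' nSy' d0.
apply: contrapT => /eqP xx'.
have [Phx xi] := positive_affine_root Px.
have [Phx' xi'] := positive_affine_root Px'.
have xz : (rank x < rank z)%N by rewrite zE; apply: rank_ltl; rewrite // -zE.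
have yz : (rank y < rank z)%N by rewrite zE; apply: rank_ltr; rewrite // -zE.
have xz' : (rank x' < rank z)%N by rewrite zE'; apply: rank_ltl; rewrite // -zE'.
have yz' : (rank y' < rank z)%N by rewrite zE'; apply: rank_ltr; rewrite // -zE'.
have bSC := ternary_biclosed_belowC bS.
pose w := x - x'.
have xE : x = x' + w by rewrite /w addrC subrK.
have yE' : y' = y + w.
  by apply: (addrI x'); rewrite -zE' zE xE -addrA [w + y]addrC.
have [Pw|Pw] : P w \/ P (- w).
  by apply: affine_root_sign; split; [exact: root_sub|rewrite rpredB].
- have Sw : S w.
    by have [||_] := below_add bS Px' Pw; rewrite -?xE // => /(_ Sx)[].
  by apply: nSy'; rewrite yE'; apply: (below_add bS _ _ _ _).1; rewrite // -yE'.
- have xE' : x' = x + - w by rewrite xE addrK.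
  have yE : y = y' + - w by rewrite yE' addrK.
  have nSw : ~ S (- w).
    by move=> Sw; apply: nSx'; rewrite xE'; apply: (below_add bS _ _ _ _).1;
      rewrite // -xE'.
  have [||_] := below_add bS Py' Pw; rewrite -?yE // => /(_ Sy)[] //.
Qed.

(* Since k < k', no -b + i delta is in S, and all -b' + i delta are; hence the
   lowest positive root over a = b + b' would be both in S and outside S. *)
Lemma below_sweep S b b' a k l k' l' : Phi a -> Phi b -> Phi b' -> a = b + b' ->
  (k + l = k' + l')%N -> below (rank (aff a (k + l))) S ->
  (shift b <= k)%N -> (shift b' <= l')%N -> (k < k')%N ->
  S (aff b k) -> S (aff b' l) -> ~ S (aff b k') -> ~ S (aff b' l') -> False.
Proof.
move=> Pa Pb Pb' aE klE bS bk bl' kk' Sbk Sbl nSbk nSbl.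
have PNb := root_opp Pb; have PNb' := root_opp Pb'.
have sNb := shiftN Pb; have sNb' := shiftN Pb'.
have bSC := ternary_biclosed_belowC bS.
have bk' : (shift b <= k')%N by lia.
have bl : (shift b' <= l)%N by lia.
have [rk rl] : (rank (aff b k) < rank (aff a (k + l)))%N /\
              (rank (aff b' l) < rank (aff a (k + l)))%N by exact: aff_rank_lt.
have [rk' rl'] : (rank (aff b k') < rank (aff a (k + l)))%N /\
              (rank (aff b' l') < rank (aff a (k + l)))%N by exact: aff_rank_lt.
have Nb i : (shift (- b) <= i)%N ->
    (rank (aff (- b) i) < rank (aff a (k + l)))%N -> ~ S (aff (- b) i).
  by move=> bi ri Si; apply: nSbk; apply: (below_opposite bS Pb _ bi) Sbk Si => //; lia.
have Nb' i : (shift (- b') <= i)%N ->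
    (rank (aff (- b') i) < rank (aff a (k + l)))%N -> S (aff (- b') i).
  move=> bi ri; apply: contrapT => Si.
  by apply: (below_opposite bSC Pb' _ bi rl ri nSbl Si) Sbl; lia.
have /andP[sl su] : (shift a <= shift b + shift b' <= (shift a).+1)%N.
  by rewrite aE shiftD // -aE.
(* The contradiction compares b' + l delta = (a + e delta) + (-b + (l - e) delta), which forces a +
   e delta into S, with b + k' delta = (a + e delta) + (-b' + (k' - e) delta). *)
pose e := shift a.
have bE : b = a - b' by rewrite aE addrK.
have bE' : b' = a - b by rewrite aE addrAC subrr add0r.
have i1 : (shift (- b') <= k' - e)%N by rewrite /e; lia.
have i2 : (shift (- b) <= l - e)%N by rewrite /e; lia.
have e1 : (k' = e + (k' - e))%N by rewrite /e; lia.
have e2 : (l = e + (l - e))%N by rewrite /e; lia.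
have [r1 r1'] := aff_rank_lt Pa PNb' Pb (leqnn e) i1 bE e1.
have [r2 r2'] := aff_rank_lt Pa PNb Pb' (leqnn e) i2 bE' e2.
have [clo _] := below_aff bS Pa PNb' Pb (leqnn e) i1 bE e1 rk'.
have [_ coclo] := below_aff bS Pa PNb Pb' (leqnn e) i2 bE' e2 rl.
have [Se|] := coclo Sbl; last by apply: Nb => //; exact: ltn_trans rl.
by apply: nSbk; apply: clo => //; apply: Nb' => //; exact: ltn_trans rk'.
Qed.

(** Equal first components force equal second ones, so the two sums differ only by their levels;
    [below_sweep] excludes either order, applied to S or to its complement. *)
Lemma below_same_chain S x y x' y' z : below (rank z) S ->
  P x -> P y -> P x' -> P y' -> P z -> z = x + y -> z = x' + y' ->
  S x -> S y -> ~ S x' -> ~ S y' -> x.1 <> x'.1.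
Proof.
move=> bS /affP[b [k [Pb bk ->]]] /affP[b' [l [Pb' bl ->]]].
move=> /affP[c [k' [_ ck' ->]]] /affP[c' [l' [_ cl' ->]]] /affP[a [t [Pa _ zE]]].
rewrite {}zE !affD in bS * => /aff_inj[aE tE] /aff_inj[aE' tE'] Sx Sy nSx' nSy' /= bc.
have bc' : b' = c' by apply: (addrI b); rewrite -aE aE' bc.
subst c c' t; have tE'' : (k' + l' = k + l)%N by [].
have bSC := ternary_biclosed_belowC bS.
have [kk'|k'k|kk'] := ltngtP k k'.
- exact: (below_sweep Pa Pb Pb' aE tE' bS bk cl' kk').
- rewrite tE' in bSC; apply: (below_sweep Pa Pb Pb' aE tE'' bSC ck' bl k'k nSx' nSy').
    by move=> /(_ Sx).
  by move=> /(_ Sy).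
- by apply: nSx'; rewrite -kk'.
Qed.

(** Two chain splittings of z coincide; a chain splitting against a sum is [below_chain_add], for S
    or its complement. For two sums, [below_exchange] and [below_same_chain] make all four inner
    products of a part of one with a part of the other nonpositive, but they add up to (z, z) >
    0. *)
Lemma affine_split_compat S x y x' y' z : below (rank z) S ->
  affine_split x y z -> affine_split x' y' z -> S x -> S y -> S x' \/ S y'.
Proof.
move=> bS; have bSC := ternary_biclosed_belowC bS.
case=> [[Px Py Pz zE]|[a [m [Pa am xE yE zE]]]];
  case=> [[Px' Py' Pz' zE']|[a' [m' [Pa' am' xE' yE' zE']]]] Sx Sy; last first.
- left; rewrite xE'; move: zE'; rewrite zE => /aff_inj[<- [<-]].
  by rewrite -xE.
- by subst x y z; exact: (below_chain_add bS Pa am).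
- have [?|nSx'] := pselect (S x'); first by left.
  have [?|nSy'] := pselect (S y'); first by right.
  subst x' y'; rewrite zE' in zE bSC.
  by have [] := below_chain_add bSC Pa' am' nSx' nSy' Px Py zE.
- have [?|nSx'] := pselect (S x'); first by left.
  have [?|nSy'] := pselect (S y'); first by right.
  exfalso; have zEC : z = y + x by rewrite addrC.
  have zEC' : z = y' + x' by rewrite addrC.
  have neg u v u' v' : P u -> P v -> P u' -> P v' -> z = u + v -> z = u' + v' ->
      S u -> S v -> ~ S u' -> ~ S v' -> dot u.1 u'.1 <= 0.
    move=> Pu Pv Pu' Pv' E E' Su Sv nSu' nSv'; rewrite leNgt; apply/negP => d0.
    apply: (below_same_chain bS Pu Pv Pu' Pv' Pz E E') => //.
    exact: (below_exchange bS Pu Pv Pu' Pv' Pz E E').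
  have z1 : z.1 = x.1 + y.1 by rewrite zE.
  have z1' : z.1 = x'.1 + y'.1 by rewrite zE'.
  have := root_dot_gt0 (positive_affine_root Pz).1.
  rewrite {1}z1 z1' !dotDl !dotDr.
  have := neg _ _ _ _ Px Py Px' Py' zE zE'.
  have := neg _ _ _ _ Px Py Py' Px' zE zEC'.
  have := neg _ _ _ _ Py Px Px' Py' zEC zE'.
  have := neg _ _ _ _ Py Px Py' Px' zEC zEC'.
  move=> /(_ Sy Sx nSy' nSx') n1 /(_ Sy Sx nSx' nSy') n2.
  move=> /(_ Sx Sy nSy' nSx') n3 /(_ Sx Sy nSx' nSy') n4.
  by lra.
Qed.

(** * From splittings to real cones *)

Definition independent x y := forall s t : R,
  s *: x.1 + t *: y.1 = 0 -> s = 0 /\ t = 0.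

(** Coordinates with respect to x and y, which reduce identities between their combinations to field
    identities. *)
Definition lin_comb x y (s t : R) : affine_space V := s *: x + t *: y.

Lemma lin_comb1 x y : x = lin_comb x y 1 0.
Proof. by rewrite /lin_comb scale1r scale0r addr0. Qed.

Lemma lin_comb2 x y : y = lin_comb x y 0 1.
Proof. by rewrite /lin_comb scale1r scale0r add0r. Qed.

Lemma lin_combD x y s t s' t' :
  lin_comb x y s t + lin_comb x y s' t' = lin_comb x y (s + s') (t + t').
Proof. by rewrite /lin_comb !scalerDl addrACA. Qed.

Lemma lin_combZ x y k s t :
  k *: lin_comb x y s t = lin_comb x y (k * s) (k * t).
Proof. by rewrite /lin_comb scalerDr !scalerA. Qed.

Lemma lin_combN x y s t : - lin_comb x y s t = lin_comb x y (- s) (- t).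
Proof. by rewrite -scaleN1r lin_combZ !mulN1r. Qed.

Lemma lin_comb_fst x y s t : (lin_comb x y s t).1 = s *: x.1 + t *: y.1.
Proof. by []. Qed.

(** Cramer's rule. *)
Lemma independent_lin_comb x y s t s' t' : independent x y ->
  s * t' - s' * t != 0 ->
  independent (lin_comb x y s t) (lin_comb x y s' t').
Proof.
move=> ind det p q.
have -> : p *: (lin_comb x y s t).1 + q *: (lin_comb x y s' t').1 =
    (lin_comb x y (p * s + q * s') (p * t + q * t')).1.
  by rewrite -lin_combD -!lin_combZ.
move=> /ind[e1 e2]; split; apply: (mulIf det).
  by rewrite mul0r; transitivity (t' * (p * s + q * s') - s' * (p * t + q * t'));
    [ring|rewrite e1 e2; ring].
by rewrite mul0r; transitivity (s * (p * t + q * t') - t * (p * s + q * s'));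
  [ring|rewrite e1 e2; ring].
Qed.

Lemma independent_sym x y : independent x y -> independent y x.
Proof. by move=> ind s t; rewrite addrC => /ind[]. Qed.

Lemma positive_scale x y k : P x -> P y -> x = k *: y -> 0 <= k -> k = 1.
Proof.
move=> /positive_affine_root[Px _] /positive_affine_root[Py _] xE k0.
have xE1 : x.1 = k *: y.1 by rewrite xE.
rewrite xE1 in Px; have [//|kE] := root_reduced Phi_root Py Px.
by move: k0; rewrite kE lerNr oppr0 ler10.
Qed.

(* If k1 < k2, the Cartan numbers of the pair x, y are -3 and -1; integrality
   of the one of z and x then gives 2 k1 - k2 = 1, hence k2 < k1. *)
Lemma cone_coef_lt x y z k1 k2 : P x -> P y -> P z -> independent x y ->
  0 < k1 < 1 -> 0 < k2 -> z = lin_comb x y k1 k2 ->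
  0 < dot z.1 x.1 -> dot z.1 y.1 <= 0 -> k2 <= k1.
Proof.
move=> /positive_affine_root[Px _] /positive_affine_root[Py _].
move=> /positive_affine_root[Pz _] ind /andP[k10 k11] k20 zE.
rewrite {1 2}zE !dotE [dot y.1 x.1]dotC => dx dy.
have xx := root_dot_gt0 Px; have yy := root_dot_gt0 Py.
have xy : dot x.1 y.1 < 0 by rewrite -(pmulr_rlt0 _ k10); have := mulr_gt0 k20 yy; lra.
have xNy : x.1 != y.1.
  by apply: contraTneq xy => ->; rewrite -leNgt ltW.
have xNNy : x.1 != - y.1.
  apply/eqP => E; have [] := ind 1 1; first by rewrite !scale1r E addNr.
  by move=> /eqP; rewrite oner_eq0.
have pq4 := cartan_number_mul_lt4 Px Py xNy xNNy.
have /intrP[q qE] := root_crystallographic Phi_root Px Py.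
have /intrP[p pE] := root_crystallographic Phi_root Py Px.
have /intrP[r rE] := root_crystallographic Phi_root Px Pz.
have rE' : r%:~R = 2 * k1 + k2 * q%:~R :> R.
  rewrite -rE -qE /cartan_number zE !dotE; field; exact: lt0r_neq0.
have qE' : q%:~R * dot x.1 x.1 = 2 * dot x.1 y.1.
  by rewrite -qE /cartan_number mulfVK // lt0r_neq0.
have pE' : p%:~R * dot y.1 y.1 = 2 * dot x.1 y.1.
  by rewrite -pE /cartan_number mulfVK ?lt0r_neq0 // dotC.
have q0 : (q < 0)%Z by rewrite -(ltr_int R) -(pmulr_llt0 _ xx) qE'; lra.
rewrite leNgt; apply/negP => k12.
(* (z, y) <= 0 says that k1 p <= -2 k2, and k2 > k1. *)
have p3 : (p < -2)%Z.
  rewrite -(ltr_int R) -(ltr_pM2r yy) pE' -(ltr_pM2l k10).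
  have := mulr_gt0 (mulr_gt0 k10 yy) ltr01.
  have : k1 * dot y.1 y.1 < k2 * dot y.1 y.1 by rewrite ltr_pM2r.
  by lra.
have {}pq4 : (q * p < 4)%Z.
  by move: pq4; rewrite qE pE -intrM -[4]/(4%:~R) ltr_int.
have q1 : q = -1 by clear - q0 p3 pq4; nia.
have r0 : (0 < r)%Z.
  rewrite -(ltr_int R) rE' -(pmulr_lgt0 _ xx) mulrDl -(mulrA k2) qE'.
  by lra.
have r2 : (r < 2)%Z by rewrite -(ltr_int R) rE' q1; lra.
have r1 : r = 1 by clear - r0 r2; lia.
by rewrite r1 q1 in rE'; lra.
Qed.

(* Induction on the total rank of the triple, applied to S and to its
   complement: an instance of x, y in S, z outside S reduces to one with a
   smaller total rank, by replacing one of the roots by a difference of two of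
   them. *)
Lemma biclosed_cone N S x y z k1 k2 : (forall k, below k S) ->
  P x -> P y -> P z -> independent x y -> 0 < k1 -> 0 < k2 ->
  z = lin_comb x y k1 k2 -> (rank x + rank y + rank z < N)%N ->
  S x -> S y -> S z.
Proof.
elim: N S x y z k1 k2 => // N IHN S x y z k1 k2 bS Px Py Pz ind k10 k20 zE.
rewrite ltnS => rN Sx Sy; apply: contrapT => nSz.
have bSC k : below k (~` S)%classic by exact: ternary_biclosed_belowC.
(* To be used for x, y in either order. If z - x' is positive, it is outside S, as z is. Then l1 >=
   1 would put it in the cone of x' and y', hence in S; and rank x' > rank (z - x') would put y' in
   the cone of z - x' and z, a smaller triple, hence outside S. *)
have step x' y' l1 l2 : P x' -> P y' -> independent x' y' -> 0 < l1 -> 0 < l2 ->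
    z = lin_comb x' y' l1 l2 -> (rank x' + rank y' + rank z <= N)%N ->
    S x' -> S y' -> 0 < dot z.1 x'.1 ->
    [/\ l1 < 1, P (z - x'), ~ S (z - x') & (rank x' <= rank (z - x'))%N].
  move=> {}Px {}Py {}ind l10 l20 {}zE {}rN {}Sx {}Sy dzx.
  have wE : z - x' = lin_comb x' y' (l1 - 1) l2.
    by rewrite zE [X in _ - X](lin_comb1 x' y') lin_combN lin_combD subr0.
  have [Phz zi] := positive_affine_root Pz.
  have [Phx xi] := positive_affine_root Px.
  have zx : z.1 != x'.1.
    apply/eqP => E; have [] := ind (l1 - 1) l2.
      by rewrite -lin_comb_fst -wE /= E subrr.
    by move=> _; apply/eqP; rewrite gt_eqF.
  have [Pw|Pw] : P (z - x') \/ P (- (z - x')).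
    by apply: affine_root_sign; split; [exact: root_sub|rewrite rpredB].
  - have zxw : z = x' + (z - x') by rewrite addrC subrK.
    have nSw : ~ S (z - x').
      move=> Sw; apply: nSz; rewrite zxw.
      by have [||+ _] := below_add (bS (rank z).+1) Px Pw; rewrite -?zxw //; apply.
    have rzE : rank z = (rank x' + rank (z - x'))%N.
      by rewrite [in LHS]zxw affine_rankD // -zxw.
    have l11 : l1 < 1.
      rewrite ltNge; apply/negP; rewrite le_eqVlt => /orP[/eqP l1E|l11].
        apply: nSw; rewrite wE -l1E subrr.
        have wE' : z - x' = l2 *: y' by rewrite wE -l1E subrr /lin_comb scale0r add0r.
        have l21 := positive_scale Pw Py wE' (ltW l20).
        by rewrite l21 -lin_comb2.
      apply: nSw; apply: (IHN S x' y' _ (l1 - 1) l2) => //; first by rewrite subr_gt0.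
      by have := affine_rank_gt0 Px; clear - rN rzE; lia.
    split=> //; rewrite leqNgt; apply/negP => rwx.
    (* y' lies between z - x' and z *)
    suff : ~ S y' by [].
    apply: (IHN (~` S)%classic (z - x') z y' (l1 / l2) ((1 - l1) / l2)) => //.
    + rewrite wE zE; apply: independent_lin_comb => //.
      have -> : (l1 - 1) * l2 - l1 * l2 = - l2 by ring.
      by rewrite oppr_eq0 gt_eqF.
    + by rewrite divr_gt0.
    + by rewrite divr_gt0 // subr_gt0.
    + rewrite {1}/lin_comb wE zE !lin_combZ lin_combD [LHS](lin_comb2 x').
      by congr lin_comb; field; rewrite gt_eqF.
    + by clear - rN rwx; lia.
  (* If x' - z is positive, it is in S because x' is and z is not; z is then in the cone of x' - z
     and y', a smaller triple. *)
  - have xzw : x' = z + - (z - x') by rewrite opprB addrC subrK.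
    have Sw : S (- (z - x')).
      have [||_] := below_add (bS (rank x').+1) Pz Pw; rewrite -?xzw //.
      by case/(_ Sx).
    have l11 : l1 < 1.
      rewrite ltNge; apply/negP => l11.
      have := affine_height_gt0 Pw.
      rewrite affine_heightN wE affine_heightD !affine_heightZ oppr_gt0 ltNge.
      apply/negP; rewrite addr_ge0 // mulr_ge0 ?subr_ge0 // ltW //;
        exact: affine_height_gt0.
    exfalso; apply: nSz.
    apply: (IHN S (- (z - x')) y' z (l1 / (1 - l1))
      (l1 * l2 / (1 - l1) + l2)) => //.
    + rewrite [X in independent _ X](lin_comb2 x') wE lin_combN.
      apply: independent_lin_comb => //.
      have -> : - (l1 - 1) * 1 - 0 * - l2 = 1 - l1 by ring.
      by rewrite subr_eq0 gt_eqF.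
    + by rewrite divr_gt0 ?subr_gt0.
    + by rewrite addr_gt0 // divr_gt0 ?subr_gt0 ?mulr_gt0.
    + rewrite {1}/lin_comb [X in _ + _ *: X](lin_comb2 x') wE lin_combN.
      rewrite !lin_combZ lin_combD zE.
      by congr lin_comb; field; rewrite subr_eq0 gt_eqF.
    + have : (rank (- (z - x')) < rank x')%N.
        by rewrite {2}xzw; apply: rank_ltr; rewrite // -xzw.
      by clear - rN; lia.
have zz := root_dot_gt0 (positive_affine_root Pz).1.
have [Phx _] := positive_affine_root Px; have [Phy _] := positive_affine_root Py.
have [Phz _] := positive_affine_root Pz.
(* (z, z) = k1 (z, x) + k2 (z, y) is positive, so one of the two inner products is. *)
wlog dzx : x y k1 k2 k10 k20 Px Py ind zE rN Sx Sy Phx Phy / 0 < dot z.1 x.1.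
  move=> wl; have [dzx|dzx] := ltP 0 (dot z.1 x.1).
    exact: (wl x y k1 k2).
  have zE' : z = lin_comb y x k2 k1 by rewrite zE /lin_comb addrC.
  apply: (wl y x k2 k1) => //; first exact: independent_sym.
    by rewrite (addnC (rank y)).
  rewrite ltNge; apply/negP => dzy; move: zz; rewrite {2}zE !dotE ltNge.
  by rewrite -[X in _ <= X]addr0 lerD // pmulr_rle0.
have [k11 Pw nSw rxw] := step x y k1 k2 Px Py ind k10 k20 zE rN Sx Sy dzx.
have zxw : z = x + (z - x) by rewrite addrC subrK.
have rzE : rank z = (rank x + rank (z - x))%N.
  by rewrite [in LHS]zxw affine_rankD // -zxw.
have hz : affine_height z = k1 * affine_height x + k2 * affine_height y.
  by rewrite zE affine_heightD !affine_heightZ.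
have hx := affine_height_gt0 Px; have hy := affine_height_gt0 Py.
(* If both are positive, x and y each have at most half the rank of z, whereas k1, k2 < 1 make z
   lower than x + y. *)
have [dzy|dzy] := ltP 0 (dot z.1 y.1).
  have zE' : z = lin_comb y x k2 k1 by rewrite zE /lin_comb addrC.
  have rN' : (rank y + rank x + rank z <= N)%N by rewrite (addnC (rank y)).
  have [k21 Pv _ ryv] :=
    step y x k2 k1 Py Px (independent_sym ind) k20 k10 zE' rN' Sy Sx dzy.
  have zyv : z = y + (z - y) by rewrite addrC subrK.
  have rzE' : rank z = (rank y + rank (z - y))%N.
    by rewrite [in LHS]zyv affine_rankD // -zyv.
  have : (rank x + rank y <= rank z)%N by clear - rxw ryv rzE rzE'; lia.
  rewrite -(ler_nat R) natrD !affine_rankE // hz => hle.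
  have : k1 * affine_height x < affine_height x by rewrite gtr_pMl.
  have : k2 * affine_height y < affine_height y by rewrite gtr_pMl.
  by lra.
have k11' : 0 < k1 < 1 by rewrite k10.
have k21 := cone_coef_lt Px Py Pz ind k11' k20 zE dzx dzy.
have wE : z - x = lin_comb x y (k1 - 1) k2.
  by rewrite zE [X in _ - X](lin_comb1 x y) lin_combN lin_combD subr0.
have [Phw wi] := positive_affine_root Pw.
have dxy : dot x.1 y.1 < 0.
  move: dzy; rewrite zE !dotE => dzy; rewrite -(pmulr_rlt0 _ k10).
  by have := mulr_gt0 k20 (root_dot_gt0 Phy); lra.
have dyw : 0 < dot y.1 (z - x).1.
  rewrite wE /= !dotE [dot y.1 x.1]dotC addr_gt0 //.
    by rewrite nmulr_rgt0 // subr_lt0.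
  by rewrite mulr_gt0 // root_dot_gt0.
have yw : y.1 != (z - x).1.
  apply/eqP => E; have [] := ind (k1 - 1) (k2 - 1).
    have -> : (k2 - 1) *: y.1 = k2 *: y.1 - y.1 by rewrite scalerBl scale1r.
    by rewrite addrA -lin_comb_fst -wE -E subrr.
  by move=> e _; lra.
(* With w = z - x, the root v = y - w is in the cone of w and z because k2 <= k1 < 1, hence
   positive. It is in S because y is and w is not, yet outside S because w and z are. *)
have [v vw] : exists v, v = y - (z - x) by exists (y - (z - x)).
have yvw : y = (z - x) + v by rewrite vw addrC subrK.
have vE : v = lin_comb (z - x) z (k1 / k2 - 1) ((1 - k1) / k2).
  rewrite {1}/lin_comb wE zE !lin_combZ lin_combD vw wE.
  rewrite [X in X - _](lin_comb2 x) lin_combN lin_combD.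
  by congr lin_comb; field; rewrite gt_eqF.
have kk : 0 <= k1 / k2 - 1 by rewrite subr_ge0 ler_pdivlMr // mul1r.
have kk' : 0 < (1 - k1) / k2 by rewrite divr_gt0 // subr_gt0.
have Pv : P v.
  apply: affine_root_positive.
    by rewrite vw; split; [exact: root_sub|rewrite rpredB // (positive_affine_root Py).2].
  rewrite vE affine_heightD !affine_heightZ ltr_wpDl //.
    by rewrite mulr_ge0 // ltW // affine_height_gt0.
  by rewrite mulr_gt0 // affine_height_gt0.
have Sv : S v.
  by have [||_] := below_add (bS (rank y).+1) Pw Pv; rewrite -?yvw // => /(_ Sy)[].
have ryE : rank y = (rank (z - x) + rank v)%N.
  by rewrite [in LHS]yvw affine_rankD // -yvw.
suff : ~ S v by [].
move: kk; rewrite le_eqVlt => /orP[/eqP kk|kk].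
  have vE' : v = ((1 - k1) / k2) *: z by rewrite vE -kk /lin_comb scale0r add0r.
  by rewrite vE' (positive_scale Pv Pz vE' (ltW kk')) scale1r.
apply: (IHN (~` S)%classic (z - x) z v _ _ bSC Pw Pz Pv _ kk kk' vE) => //; last first.
  by have := affine_rank_gt0 Px; clear - rN ryE; lia.
rewrite wE zE; apply: independent_lin_comb => //.
have -> : (k1 - 1) * k2 - k1 * k2 = - k2 by ring.
by rewrite oppr_eq0 gt_eqF.
Qed.

(** * Real closedness against closedness for splittings *)

Lemma affine_split_cone x y z : affine_split x y z ->
  exists k1 k2 : R, [/\ 0 <= k1, 0 <= k2 & z = k1 *: x + k2 *: y].
Proof.
case=> [[_ _ _ ->]|[a [m [Pa am -> -> ->]]]]; first by exists 1, 1; rewrite !scale1r.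
(* x + y is (m + i) delta, so z = x + delta = x + k (x + y). *)
pose i := (m.+1 - shift a)%N; pose k : R := (m + i)%:R^-1.
have mi : (m + i)%:R != 0 :> R by rewrite pnatr_eq0 /i; lia.
exists (1 + k), k; split; rewrite ?addr_ge0 ?invr_ge0 //.
rewrite /aff -/i; congr (_, _) => /=.
  by rewrite scalerN scalerDl scale1r addrK.
rewrite /GRing.scale /= mulrDl mul1r -addrA -mulrDr -natrD mulVf //.
by rewrite natr1.
Qed.

(** Since [Phi] is reduced, k1 + k2 = 1 if c = b, and z lies between the two roots; if c = -b, then
    k1 - k2 is 1 or -1, and z lies above one of them, over the same root of [Phi]. *)
Lemma biclosed_parallel_cone S b m c l z (k1 k2 : R) : (forall k, below k S) ->
  Phi b -> (shift b <= m)%N -> (shift c <= l)%N -> c = b \/ c = - b ->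
  0 <= k1 -> 0 <= k2 -> P z -> z = k1 *: aff b m + k2 *: aff c l ->
  S (aff b m) -> S (aff c l) -> S z.
Proof.
move=> bS Pb bm cl cE k10 k20 /affP[d [t [Pd dt ->]]].
rewrite {1 2 3}/aff => -[dE]; rewrite /GRing.scale /= => tE Sm Sl.
case: cE => ?; subst c.
  move: dE; rewrite -scalerDl => dE.
  have k12 : k1 + k2 = 1.
    move: Pd; rewrite dE => /(root_reduced Phi_root Pb)[//|].
    by have := addr_ge0 k10 k20; lra.
  rewrite k12 scale1r in dE; subst d.
  wlog ml : k1 k2 m l bm cl k10 k20 tE Sm Sl k12 / (m <= l)%N.
    move=> wl; have [ml|/ltnW lm] := leqP m l; first exact: (wl k1 k2 m l).
    rewrite addrC in tE; rewrite addrC in k12.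
    exact: (wl k2 k1 l m cl bm k20 k10 tE Sl Sm k12 lm).
  apply: (below_between (bS (rank (aff b l)).+1) Pb bm _ _ Sm Sl) => //.
  have mlR : m%:R <= l%:R :> R by rewrite ler_nat.
  have := ler_wpM2l k10 mlR; have := ler_wpM2l k20 mlR.
  have := mulrDl k1 k2 (m%:R : R); have := mulrDl k1 k2 (l%:R : R).
  by rewrite k12 !mul1r -!(ler_nat R) tE => *; apply/andP; split; lra.
have PNb := root_opp Pb.
move: dE; rewrite scalerN -scalerBl => dE.
have [k12|k12] : k1 - k2 = 1 \/ k1 - k2 = -1.
  by move: Pd; rewrite dE => /(root_reduced Phi_root Pb).
- rewrite k12 scale1r in dE; subst d.
  pose r := (maxn (rank (aff b t)) (rank (aff (- b) l))).+1.
  apply: (below_opposite (bS r) Pb _ cl _ _ Sm Sl); rewrite ?ltnS ?leq_maxl ?leq_maxr //.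
  rewrite bm -(ler_nat R) tE (_ : k1 = 1 + k2); last by lra.
  by rewrite mulrDl mul1r -addrA lerDl addr_ge0 // mulr_ge0.
- rewrite k12 scaleN1r in dE; subst d.
  pose r := (maxn (rank (aff (- b) t)) (rank (aff b m))).+1.
  rewrite -[b]opprK in Sm.
  apply: (below_opposite (bS r) PNb _ _ _ _ Sl Sm);
    rewrite ?opprK ?ltnS ?leq_maxl ?leq_maxr //.
  rewrite cl -(ler_nat R) tE (_ : k2 = 1 + k1); last by lra.
  by rewrite mulrDl mul1r addrCA lerDl addr_ge0 // mulr_ge0.
Qed.

(** Either the components in V are equal or opposite, or a coefficient vanishes and the combination
    is x or y itself, or [biclosed_cone] applies, since proportional roots are equal or opposite. *)
Lemma biclosed_real_cone S x y (k1 k2 : R) : (forall k, below k S) ->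
  P x -> P y -> 0 <= k1 -> 0 <= k2 -> P (k1 *: x + k2 *: y) ->
  S x -> S y -> S (k1 *: x + k2 *: y).
Proof.
move=> bS Px Py k10 k20 Pz Sx Sy.
have [parallel|] := pselect (y.1 = x.1 \/ y.1 = - x.1).
  move: parallel Pz Sx Sy.
  have /affP[b [m [Pb bm ->]]] := Px; have /affP[c [l [_ cl ->]]] := Py.
  move=> /= cE Pz Sx Sy.
  exact: (biclosed_parallel_cone bS Pb bm cl cE k10 k20 Pz erefl Sx Sy).
move=> /not_orP[yx yNx].
move: k10; rewrite le_eqVlt => /orP[/eqP k10|k10].
  move: Pz; rewrite -k10 scale0r add0r => Pz.
  by rewrite (positive_scale Pz Py erefl k20) scale1r.
move: k20; rewrite le_eqVlt => /orP[/eqP k20|k20].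
  move: Pz; rewrite -k20 scale0r addr0 => Pz.
  by rewrite (positive_scale Pz Px erefl (ltW k10)) scale1r.
apply: (biclosed_cone (N := (rank x + rank y + rank (k1 *: x + k2 *: y)).+1) bS
  Px Py Pz _ k10 k20) => // s t st.
have [Phx _] := positive_affine_root Px; have [Phy _] := positive_affine_root Py.
have t0 : t = 0.
  apply/eqP; apply: contrapT => /negP t0.
  have : y.1 = (- (s / t)) *: x.1.
    apply: (scalerI t0); rewrite scalerA mulrN mulrCA divff // mulr1 scaleNr.
    by apply/eqP; rewrite -addr_eq0 addrC st.
  by move=> /(root_scale_eq Phy Phx)[].
split=> //; move: st; rewrite t0 scale0r addr0 => /eqP.
by rewrite scaler_eq0 (negPf (root_neq0 Phi_root Phx)) orbF => /eqP.
Qed.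

(** Splittings are real combinations by [affine_split_cone]. Conversely [biclosed_real_cone] applies
    to S and, the conditions on splittings being self-dual, to its complement. *)
Lemma biclosed_affine_splitP S : biclosed P S <->
  [/\ S `<=` P, ternary_closed affine_split S &
      ternary_coclosed affine_split S]%classic.
Proof.
split=> [[[sSP clS] [_ coS]]|[sSP clS coS]].
  split=> // x y z Sxyz; have [Px Py Pz] := affine_split_positive Sxyz;
    have [k1 [k2 [k10 k20 zE]]] := affine_split_cone Sxyz.
    by move=> Sx Sy; rewrite zE; apply: clS; rewrite -?zE.
  move=> Sz; apply: contrapT => /not_orP[nSx nSy].
  rewrite zE in Pz Sz.
  by have [_ []] := coS x y k1 k2 (conj Px nSx) (conj Py nSy) k10 k20 Pz.
have bS k : below k S by move=> x y z Sxyz _; split; [exact: clS|exact: coS].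
have bSC k : below k (~` S)%classic by exact: ternary_biclosed_belowC.
split; split=> //.
- by move=> x y k1 k2 Sx Sy k10 k20 Pz; apply: biclosed_real_cone => //; exact: sSP.
- move=> x y k1 k2 [Px nSx] [Py nSy] k10 k20 Pz; split=> //.
  exact: (biclosed_real_cone bSC).
Qed.

End AffineRootSystem.

(** * Algebraicity of the lattice *)

Theorem corollary5p3 (R : realType) (V : vectType R) (dot : {dot V for idfun}%R)
    (Phi : set V) (Pi : 2.-tuple V) (X : rank2_type) :
  root_system dot Phi ->
  irreducible_root_system dot Phi ->
  simple_system Phi Pi ->
  has_rank2_type dot Pi X ->
  algebraic_lattice (biclosed_set (affine_positive_roots Phi Pi)).
Proof.
move=> Phi_root _ Pi_simple _.
have [M height_lt] := height_bounded Phi_root Pi.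
apply: (@biclosed_algebraic _ _ _ (affine_split Phi Pi) (affine_rank Pi M)).
- by move=> x y z; exact: (affine_split_rank_lt Phi_root Pi_simple height_lt).
- by move=> S x y x' y' z; exact: (affine_split_compat Phi_root Pi_simple height_lt).
- by move=> x y z /(affine_split_positive Phi_root Pi_simple)[].
- exact: (affine_rank_finite Phi_root Pi_simple height_lt).
- exact: (biclosed_affine_splitP Phi_root Pi_simple height_lt).
Qed.
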